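(* Let $\rho$ be an $n$-qubit density operator, $O$ a Hermitian observable, and consider the parametrized circuit $$U(\vec{\theta})=\prod_{l=1}^{m} V_l e^{-i\theta_l H_l}=V_1e^{-i\theta_1H_1}V_2e^{-i\theta_2H_2}\cdots V_me^{-i\theta_mH_m},$$ with fixed unitaries $V_l$, Hermitian generators $H_l$ and $m$ independent parameters $\vec\theta=(\theta_1,\dots,\theta_m)\in\mathbb{R}^m$, each generator having its own parameter (i.e. the number of generators $M$ equals $m$). Let $\mathcal{L}(\vec\theta)=\operatorname{Tr}[U(\vec\theta)\rho U^\dagger(\vec\theta)O]=\operatorname{Tr}[\rho\,U^\dagger(\vec\theta)OU(\vec\theta)]$. Fix any point $\vec\phi\in\mathbb{R}^m$ and any subset $\Lambda\subseteq\{1,\dots,m\}$. Define $$c_l(\vec\phi)=\left|\frac{\partial^2\mathcal{L}}{\partial\theta_l^2}(\vec\phi)\right|,\quad \omega^{(\max)}_\mu=\lambda_{\max}(H_\mu)-\lambda_{\min}(H_\mu),$$ $$\omega^{(\mathrm{eff})}_\mu(\vec\phi)=\sqrt{\Big\|\tfrac{\partial^2}{\partial\theta_\mu^2}[U(\vec\theta)^\dagger OU(\vec\theta)]\big|_{\vec\theta=\vec\phi}\Big\|_\infty},\quad \widetilde\omega^{(\mathrm{eff})}_{l,\mu}(\vec\phi)=\sqrt{\Big\|\tfrac{\partial^4}{\partial\theta_\mu^2\partial\theta_l^2}[U(\vec\theta)^\dagger OU(\vec\theta)]\big|_{\vec\theta=\vec\phi}\Big\|_\infty},$$ $$\beta_l=\tfrac{32}{3}(\omega^{(\max)}_l)^6\|O\|_\infty^2\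 \text{ for } l>1,\qquad \beta_1=\tfrac{2}{3}(\omega^{(\max)}_1)^2(\omega^{(\mathrm{eff})}_1(\vec\phi))^4,$$ $$\mathcal{A}_l(\vec\phi)=4(\omega^{(\max)}_l)^2\sum_{\mu=1}^{l-1}(\omega^{(\mathrm{eff})}_\mu(\vec\phi))^2+\sum_{\mu=l+1}^{m}(\widetilde\omega^{(\mathrm{eff})}_{l,\mu}(\vec\phi))^2,$$ and $$r_{\mathrm{patch}}^2:=\min_{l\in\Lambda}\frac{9c_l(\vec\phi)^2}{8c_l(\vec\phi)\mathcal{A}_l(\vec\phi)+24\beta_l}.$$ Then for every $r>0$ with $r^2\le r_{\mathrm{patch}}^2$, $$\operatorname{Var}_{\vec\theta\sim\mathcal{U}(\vec\phi,r)}[\mathcal{L}(\vec\theta)]\ \ge\ \sum_{l\in\Lambda}\frac{r^4}{45}\left(\Big(c_l(\vec\phi)-\tfrac16\mathcal{A}_l(\vec\phi)\,r^2\Big)^2-\beta_l r^2\right),$$ and moreover $$\operatorname{Var}_{\vec\theta\sim\mathcal{U}(\vec\phi,r_{\mathrm{patch}})}[\mathcal{L}(\vec\theta)]\ \ge\ \frac{1}{72}\Big(\sum_{l\in\Lambda}c_l(\vec\phi)^2\Big)r_{\mathrm{patch}}^4.$$ Finally, for a family of such instances indexed by $n$ with $\|O\|_\infty,\|H_k\|_\infty\in\mathcal{O}(\mathrm{poly}(n))$ and $c_q(\vec\phi)\in\Omega(1/\mathrm{poly}(n))$ for some $q\in\Lambda$, choosing $r\in\Theta\big(1/(\mathrm{poly}(n)\sqrt{m})\big)$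 gives $$\operatorname{Var}_{\vec\theta\sim\mathcal{U}(\vec\phi,r)}[\mathcal{L}(\vec\theta)]\in\Omega\Big(\frac{1}{\mathrm{poly}(n)\,m^2}\Big).$$
   Context: $\|\cdot\|_\infty$ is the operator norm. For $\vec\phi\in\mathbb{R}^m$ and $r>0$, $\mathcal{U}(\vec\phi,r)$ is the uniform distribution over the hypercube $\{\vec\theta:\theta_i\in[\phi_i-r,\phi_i+r],\ i=1,\dots,m\}$ (coordinates independent and uniform). Note the ordering convention: generator $H_1$ is the gate adjacent to the observable in the Heisenberg picture $U^\dagger OU$, and $H_m$ is the gate adjacent to the initial state $\rho$. $\lambda_{\max},\lambda_{\min}$ denote largest and smallest eigenvalues. *)

(* Defs.v *)
From HB Require Import structures.
From mathcomp Require Import all_boot all_order all_algebra.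
From mathcomp Require Import all_classical all_reals all_analysis.
From mathcomp Require Import complex.
Set Implicit Arguments. Unset Strict Implicit. Unset Printing Implicit Defensive.
Import Order.TTheory GRing.Theory Num.Theory.
Import numFieldTopology.Exports numFieldNormedType.Exports.
Local Open Scope ring_scope.
Local Open Scope classical_set_scope.

Definition qdim (n : nat) : nat := (2 ^ n)%N.

Definition adj {R : realType} {p q : nat} (A : 'M[R[i]]_(p, q)) : 'M[R[i]]_(q, p) :=
  (map_mx (@conjc R) A)^T.

Definition is_hermitian {R : realType} {d : nat} (A : 'M[R[i]]_d) : Prop := adj A = A.

Definition unitary {R : realType} {d : nat} (V : 'M[R[i]]_d) : Prop :=
  V *m adj V = 1%:M /\ adj V *m V = 1%:M.

Definition psd {R : realType} {d : nat} (A : 'M[R[i]]_d) : Prop :=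
  forall v : 'cV[R[i]]_d, 0 <= (adj v *m A *m v) ord0 ord0.

Definition density_operator {R : realType} {d : nat} (rho : 'M[R[i]]_d) : Prop :=
  [/\ is_hermitian rho, psd rho & \tr rho = 1].

Definition vnorm {R : realType} {d : nat} (v : 'cV[R[i]]_d) : R :=
  Num.sqrt (\sum_(k < d) ComplexField.Normc.normc (v k ord0) ^+ 2).

Definition opnorm {R : realType} {d : nat} (A : 'M[R[i]]_d) : R :=
  sup [set vnorm (A *m v) | v in [set v : 'cV[R[i]]_d | vnorm v <= 1]].

(* largest / smallest eigenvalue of a Hermitian matrix (its eigenvalues are real) *)
Definition lambda_max {R : realType} {d : nat} (H : 'M[R[i]]_d) : R :=
  sup [set x : R | eigenvalue H (x%:C)%C].
Definition lambda_min {R : realType} {d : nat} (H : 'M[R[i]]_d) : R :=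
  inf [set x : R | eigenvalue H (x%:C)%C].

Definition expmx {R : realType} {d : nat} (A : 'M[R[i]]_d) : 'M[R[i]]_d :=
  lim ((fun k : nat =>
          (\sum_(j < k) (j`!%:R)^-1 *: A ^+ j : 'M[(R[i] : numFieldType)]_d)) @ \oo).

Definition upd {R : realType} {m : nat} (th : 'I_m -> R) (l : 'I_m) (s : R) : 'I_m -> R :=
  fun k => if k == l then s else th k.

Definition pd {R : realType} {m : nat} (l : 'I_m) (f : ('I_m -> R) -> R) : ('I_m -> R) -> R :=
  fun th => derive1 (fun s => f (upd th l s)) (th l).

Definition dmx {R : realType} {d : nat} (F : R -> 'M[R[i]]_d) (t : R) : 'M[R[i]]_d :=
  \matrix_(a, b) ((derive1 (fun s => @complex.Re R (F s a b)) t) +i* (derive1 (fun s => @complex.Im R (F s a b)) t))%C.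

Definition pdmx {R : realType} {d m : nat} (l : 'I_m) (G : ('I_m -> R) -> 'M[R[i]]_d)
  : ('I_m -> R) -> 'M[R[i]]_d :=
  fun th => dmx (fun s => G (upd th l s)) (th l).

(* U(theta) = V_1 e^{-i theta_1 H_1} V_2 e^{-i theta_2 H_2} ... V_m e^{-i theta_m H_m}
   (index l : 'I_m corresponds to l+1 in the paper) *)
Definition circuit {R : realType} {d m : nat} (V H : 'I_m -> 'M[R[i]]_d) (th : 'I_m -> R)
  : 'M[R[i]]_d :=
  \prod_(l < m) (V l *m expmx ((- ('i%C * (th l)%:C%C)) *: H l)).

Definition heis {R : realType} {d m : nat} (O : 'M[R[i]]_d) (V H : 'I_m -> 'M[R[i]]_d)
  (th : 'I_m -> R) : 'M[R[i]]_d :=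
  adj (circuit V H th) *m O *m circuit V H th.

(* loss L(theta) = Tr[U rho U^dagger O] (real since rho, O are Hermitian) *)
Definition loss {R : realType} {d m : nat} (rho O : 'M[R[i]]_d) (V H : 'I_m -> 'M[R[i]]_d)
  (th : 'I_m -> R) : R :=
  @complex.Re R (\tr (circuit V H th *m rho *m adj (circuit V H th) *m O)).

Fixpoint iavg {R : realType} {m : nat} (phi : 'I_m -> R) (r : R) (s : seq 'I_m)
  (f : ('I_m -> R) -> R) (th : 'I_m -> R) {struct s} : R :=
  match s with
  | [::] => f th
  | l :: s' => (2 * r)^-1 *
      Rintegral lebesgue_measure `[phi l - r, phi l + r] (fun x => iavg phi r s' f (upd th l x))
  end.

(* E_{theta ~ U(phi, r)} [f(theta)] (coordinates independent and uniform) *)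
Definition unif_mean {R : realType} {m : nat} (phi : 'I_m -> R) (r : R)
  (f : ('I_m -> R) -> R) : R := iavg phi r (enum 'I_m) f phi.

Definition unif_var {R : realType} {m : nat} (phi : 'I_m -> R) (r : R)
  (f : ('I_m -> R) -> R) : R :=
  unif_mean phi r (fun th => f th ^+ 2) - (unif_mean phi r f) ^+ 2.

Definition c_coef {R : realType} {d m : nat} (rho O : 'M[R[i]]_d) (V H : 'I_m -> 'M[R[i]]_d)
  (phi : 'I_m -> R) (l : 'I_m) : R :=
  `| pd l (pd l (loss rho O V H)) phi |.

Definition omega_max {R : realType} {d m : nat} (H : 'I_m -> 'M[R[i]]_d) (mu : 'I_m) : R :=
  lambda_max (H mu) - lambda_min (H mu).

Definition omega_eff {R : realType} {d m : nat} (O : 'M[R[i]]_d) (V H : 'I_m -> 'M[R[i]]_d)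
  (phi : 'I_m -> R) (mu : 'I_m) : R :=
  Num.sqrt (opnorm (pdmx mu (pdmx mu (heis O V H)) phi)).

Definition omega_teff {R : realType} {d m : nat} (O : 'M[R[i]]_d) (V H : 'I_m -> 'M[R[i]]_d)
  (phi : 'I_m -> R) (l mu : 'I_m) : R :=
  Num.sqrt (opnorm (pdmx mu (pdmx mu (pdmx l (pdmx l (heis O V H)))) phi)).

(* beta_l ; the paper's l = 1 is the index 0 here *)
Definition beta {R : realType} {d m : nat} (O : 'M[R[i]]_d) (V H : 'I_m -> 'M[R[i]]_d)
  (phi : 'I_m -> R) (l : 'I_m) : R :=
  if val l == 0%N then 2 / 3 * omega_max H l ^+ 2 * omega_eff O V H phi l ^+ 4
  else 32 / 3 * omega_max H l ^+ 6 * opnorm O ^+ 2.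

Definition A_coef {R : realType} {d m : nat} (O : 'M[R[i]]_d) (V H : 'I_m -> 'M[R[i]]_d)
  (phi : 'I_m -> R) (l : 'I_m) : R :=
  4 * omega_max H l ^+ 2 * (\sum_(mu < m | (mu < l)%N) omega_eff O V H phi mu ^+ 2)
  + \sum_(mu < m | (l < mu)%N) omega_teff O V H phi l mu ^+ 2.

Definition rpatch2 {R : realType} {d m : nat} (rho O : 'M[R[i]]_d) (V H : 'I_m -> 'M[R[i]]_d)
  (phi : 'I_m -> R) (Lam : {set 'I_m}) : R :=
  inf [set 9 * c_coef rho O V H phi l ^+ 2 /
           (8 * c_coef rho O V H phi l * A_coef O V H phi l + 24 * beta O V H phi l)
      | l in [set l : 'I_m | l \in Lam]].

(* Main.v *)
Require Import Defs.
From HB Require Import structures.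
From mathcomp Require Import all_boot all_order all_algebra.
From mathcomp Require Import all_classical all_reals all_analysis.
From mathcomp Require Import complex.
From mathcomp Require Import ring lra.
Import Order.TTheory GRing.Theory Num.Theory.
Import numFieldTopology.Exports numFieldNormedType.Exports.
Set Implicit Arguments. Unset Strict Implicit. Unset Printing Implicit Defensive.
Local Open Scope ring_scope.
Local Open Scope classical_set_scope.

(** Write q_l for the second Legendre polynomial of the coordinate l on the cube, i.e.
    (th_l - phi_l)^2 - r^2/3.  The q_l are centred and orthogonal under the uniform law, so
    Bessel's inequality bounds the variance below by the sum of E[L q_l]^2 / E[q_l^2], where
    E[q_l^2] = 4r^4/45.  Two integrations by parts turn E[L q_l] into 2r^4/45 times a weighted
    mean of the curvature d_l^2 L, with weight proportional to ((th_l - phi_l)^2 - r^2)^2 in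
    the coordinate l.

    That mean is compared with the curvature at phi by randomizing the coordinates one at a
    time, the last one first.  Every mean used is centred at phi, so each step only costs a
    bound on a second derivative: r^2/6 times it for a uniform coordinate, r^2/14 times it for
    the weighted one.  When coordinate k is randomized the earlier ones still sit at phi; as
    the operator norm of a derivative of U^+ O U only depends on the coordinates before the
    last differentiated one, these second derivatives are controlled by data at phi: this
    yields A_l r^2/6, and beta_l r^2 for the step k = l. *)

(** * Means of separable functions *)

(** The slope of L at phi has no sign or size to rely on; the second Legendre polynomial is the
    lowest-degree test function orthogonal to affine functions, so that its correlation with L sees
    curvature only. The mean over the cube is an iterated integral, and the argument keeps
    reordering it. The loss is a finite sum of products of continuous functions of one coordinate
    each ([sep]), so every exchange follows from linearity of one-dimensional means and no product
    measure appears. Halving the second moments r^2/3 and r^2/7 of the two means gives 1/6 and 1/14.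
    Let a = c_l - A_l r^2/6, and let M bound the norm of d_l^2 of U^+ O U at every point. The step k
    = l costs delta = omega_l^2 M r^2/14, and (a - delta)^2 >= a^2 - 2 a delta with 2 a delta <= 2 M
    delta = omega_l^2 M^2 r^2/7 <= beta_l r^2, as beta_l >= (2/3) omega_l^2 M^2. Squaring needs a >=
    0, that is A_l r^2 <= 6 c_l, which r <= r_patch ensures. Within the patch, the bracket of each
    summand is at least (5/8) c_l^2, and 5/(8 * 45) = 1/72. *)

Section Means.
Variable R : realType.

Definition umean (a r : R) (u : R -> R) : R :=
  (2 * r)^-1 * Rintegral lebesgue_measure `[a - r, a + r] u.

(** Linearity is asked on continuous functions, for which integrability on a compact interval is
    automatic. The interface serves both the uniform and the weighted mean. *)
Record is_mean (lam : (R -> R) -> R) : Prop := IsMean {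
  mean_lin : forall (a : R) (f g : R -> R), continuous f -> continuous g ->
    lam (fun x => a * f x + g x) = a * lam f + lam g;
  mean_ge0 : forall f : R -> R, continuous f -> (forall x, 0 <= f x) -> 0 <= lam f;
  mean_one : lam (fun=> 1) = 1 }.

Lemma continuous_add (f g : R -> R) : continuous f -> continuous g ->
  continuous (fun x => f x + g x).
Proof. by move=> cf cg x; apply: cvgD; [exact: cf|exact: cg]. Qed.

Lemma continuous_mul (f g : R -> R) : continuous f -> continuous g ->
  continuous (fun x => f x * g x).
Proof. by move=> cf cg x; apply: cvgM; [exact: cf|exact: cg]. Qed.

Lemma continuous_cst (a : R) : continuous (fun _ : R => a).
Proof. by move=> x; apply: cvg_cst. Qed.
Arguments continuous_cst : clear implicits.

Lemma continuous_bigsum (I : finType) (u : I -> R -> R) :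
  (forall i, continuous (u i)) -> continuous (fun x => \sum_i u i x).
Proof.
move=> cu; elim: (index_enum I) => [|i s IH].
  under eq_fun do rewrite big_nil.
  exact: continuous_cst.
under eq_fun do rewrite big_cons.
exact: continuous_add.
Qed.

Section OneMean.
Variables (lam : (R -> R) -> R) (hlam : is_mean lam).

Lemma mean_zero : lam (fun=> 0) = 0.
Proof.
have := mean_lin hlam 1 (continuous_cst 0) (continuous_cst 0).
under eq_fun do rewrite mulr0 addr0.
by rewrite mul1r => /eqP; rewrite -subr_eq0 opprD addNKr oppr_eq0 => /eqP.
Qed.

Lemma meanZ (a : R) (f : R -> R) : continuous f -> lam (fun x => a * f x) = a * lam f.
Proof.
move=> cf; have := mean_lin hlam a cf (continuous_cst 0).
by rewrite mean_zero addr0 => <-; under [in RHS]eq_fun do rewrite addr0.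
Qed.

Lemma meanD (f g : R -> R) : continuous f -> continuous g ->
  lam (fun x => f x + g x) = lam f + lam g.
Proof.
move=> cf cg; have := mean_lin hlam 1 cf cg.
by rewrite mul1r => <-; under [in RHS]eq_fun do rewrite mul1r.
Qed.

Lemma mean_cst (a : R) : lam (fun=> a) = a.
Proof.
by rewrite -[RHS]mulr1 -(mean_one hlam) -meanZ;
  [under [in RHS]eq_fun do rewrite mulr1|exact: continuous_cst].
Qed.

Lemma mean_le (f g : R -> R) : continuous f -> continuous g ->
  (forall x, f x <= g x) -> lam f <= lam g.
Proof.
move=> cf cg fg; rewrite -subr_ge0.
have -> : lam g - lam f = lam (fun x => -1 * f x + g x).
  by rewrite mean_lin// mulN1r addrC.
apply: mean_ge0 => //; first exact: continuous_add (continuous_mul (continuous_cst _) cf) cg.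
by move=> x; rewrite mulN1r addrC subr_ge0.
Qed.

Lemma mean_sum (I : finType) (a : I -> R) (u : I -> R -> R) :
  (forall i, continuous (u i)) ->
  lam (fun x => \sum_i a i * u i x) = \sum_i a i * lam (u i).
Proof.
move=> cu; have cau s : continuous (fun x => \sum_(i <- s) a i * u i x).
  elim: s => [|i s IH].
    by under eq_fun do rewrite big_nil; exact: continuous_cst.
  under eq_fun do rewrite big_cons.
  exact: continuous_add (continuous_mul (continuous_cst _) _) IH.
elim: (index_enum I) => [|i s IH].
  by under eq_fun do rewrite big_nil; rewrite big_nil mean_zero.
under eq_fun do rewrite big_cons.
by rewrite big_cons mean_lin// IH.
Qed.

End OneMean.

(** For a kernel of finite rank both sides equal the sum of [a i * mu (u i) * lam (v i)]: linearity
    replaces Fubini. *)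
Lemma mean_swap (lam mu : (R -> R) -> R) (I : finType) (a : I -> R) (u v : I -> R -> R) :
  is_mean lam -> is_mean mu ->
  (forall i, continuous (u i)) -> (forall i, continuous (v i)) ->
  lam (fun y => mu (fun x => \sum_i a i * u i x * v i y)) =
  mu (fun x => lam (fun y => \sum_i a i * u i x * v i y)).
Proof.
move=> hl hm cu cv.
transitivity (lam (fun y => \sum_i (a i * mu (u i)) * v i y)).
  congr lam; apply/funext => y.
  transitivity (mu (fun x => \sum_i (a i * v i y) * u i x)).
    by congr mu; apply/funext => x; apply: eq_bigr => i _; rewrite mulrAC.
  by rewrite mean_sum//; apply: eq_bigr => i _; rewrite mulrAC.
rewrite mean_sum//.
transitivity (mu (fun x => \sum_i (a i * lam (v i)) * u i x)).
  by rewrite mean_sum//; apply: eq_bigr => i _; rewrite mulrAC.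
congr mu; apply/funext => x; rewrite mean_sum//.
by apply: eq_bigr => i _; rewrite mulrAC.
Qed.

End Means.

Section Separable.
Variables (R : realType) (m : nat).
Implicit Types (f g : ('I_m -> R) -> R) (th : 'I_m -> R).

Lemma upd_same th (k : 'I_m) (x : R) : upd th k x k = x.
Proof. by rewrite /upd eqxx. Qed.

Lemma upd_diff th (k l : 'I_m) (x : R) : l != k -> upd th k x l = th l.
Proof. by rewrite /upd => /negbTE ->. Qed.

Lemma upd_id th (k : 'I_m) : upd th k (th k) = th.
Proof. by apply/funext => l; rewrite /upd; case: eqP => // ->. Qed.

Lemma updC th (k l : 'I_m) (x y : R) : k != l ->
  upd (upd th k x) l y = upd (upd th l y) k x.
Proof.
move=> kl; apply/funext => i; rewrite /upd.
by have [->|//] := eqVneq i l; rewrite eq_sym (negbTE kl).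
Qed.

(** The algebraic tensor product of the continuous functions of each coordinate. It is stable under
    sums, products and averaging in one coordinate, and yields both continuity along coordinate
    lines and the exchange of means. *)
Definition sep f : Prop :=
  exists (J : finType) (a : J -> R) (t : J -> 'I_m -> R -> R),
    (forall j k, continuous (t j k)) /\
    f = (fun th => \sum_j a j * \prod_k t j k (th k)).

Lemma sep_cst (a : R) : sep (fun=> a).
Proof.
exists unit, (fun=> a), (fun _ _ => fun=> 1); split.
  by move=> _ k; exact: continuous_cst.
apply/funext => th; rewrite (big_pred1 tt) => [|[]//].
by rewrite big1 ?mulr1.
Qed.

Lemma sep_coord (k : 'I_m) (u : R -> R) : continuous u -> sep (fun th => u (th k)).
Proof.
move=> cu; exists unit, (fun=> 1), (fun _ i => if i == k then u else fun=> 1); split.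
  by move=> _ i; case: ifP => // _; exact: continuous_cst.
apply/funext => th; rewrite (big_pred1 tt) => [|[]//].
rewrite (bigD1 k)//= eqxx big1 ?mulr1 ?mul1r//.
by move=> i /negbTE ->.
Qed.

Lemma sepD f g : sep f -> sep g -> sep (fun th => f th + g th).
Proof.
move=> [I [a [t [ct ->]]]] [J [b [u [cu ->]]]].
exists (I + J)%type, (fun ij => match ij with inl i => a i | inr j => b j end),
  (fun ij => match ij with inl i => t i | inr j => u j end); split.
  by case.
by apply/funext => th; rewrite big_sumType.
Qed.

Lemma sepM f g : sep f -> sep g -> sep (fun th => f th * g th).
Proof.
move=> [I [a [t [ct ->]]]] [J [b [u [cu ->]]]].
exists (I * J)%type, (fun ij => a ij.1 * b ij.2),
  (fun ij k x => t ij.1 k x * u ij.2 k x); split.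
  by move=> [i j] k; exact: continuous_mul.
apply/funext => th; rewrite big_distrlr/= pair_bigA/=; apply: eq_bigr => -[i j] _ /=.
by rewrite big_split/= mulrACA.
Qed.

Lemma sepZ (a : R) f : sep f -> sep (fun th => a * f th).
Proof. exact: sepM (sep_cst a). Qed.

Lemma sepN f : sep f -> sep (fun th => - f th).
Proof.
by move=> /(sepZ (-1)); rewrite (_ : (fun th => -1 * f th) = fun th => - f th)//;
  apply/funext => th; rewrite mulN1r.
Qed.

Lemma sepB f g : sep f -> sep g -> sep (fun th => f th - g th).
Proof. by move=> sf /sepN; exact: sepD. Qed.

Lemma sep_sum (I : Type) (s : seq I) (P : pred I) (F : I -> ('I_m -> R) -> R) :
  (forall i, sep (F i)) -> sep (fun th => \sum_(i <- s | P i) F i th).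
Proof.
move=> sF; elim: s => [|i s IH].
  by under eq_fun do rewrite big_nil; exact: sep_cst.
under eq_fun do rewrite big_cons.
by case: (P i) => //; exact: sepD.
Qed.

Lemma prod_upd (t : 'I_m -> R -> R) th (k : 'I_m) (x : R) :
  \prod_i t i (upd th k x i) = t k x * \prod_(i | i != k) t i (th i).
Proof.
rewrite (bigD1 k)//= upd_same; congr (_ * _); apply: eq_bigr => i ik.
by rewrite upd_diff.
Qed.

Lemma sep_line f th (k : 'I_m) : sep f -> continuous (fun x => f (upd th k x)).
Proof.
move=> [J [a [t [ct ->]]]]; apply: continuous_bigsum => j.
under eq_fun do rewrite prod_upd.
apply: continuous_mul; first exact: continuous_cst.
by apply: continuous_mul => //; exact: continuous_cst.
Qed.

Lemma sep_mean (lam : (R -> R) -> R) f (k : 'I_m) : is_mean lam -> sep f ->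
  sep (fun th => lam (fun x => f (upd th k x))).
Proof.
move=> hl [J [a [t [ct ->]]]].
exists J, a, (fun j i => if i == k then fun=> lam (t j k) else t j i); split.
  by move=> j i; case: ifP => // _; exact: continuous_cst.
apply/funext => th.
transitivity (lam (fun x => \sum_j (a j * \prod_(i | i != k) t j i (th i)) * t j k x)).
  congr lam; apply/funext => x; apply: eq_bigr => j _.
  by rewrite prod_upd [t j k x * _]mulrC mulrA.
rewrite mean_sum//; apply: eq_bigr => j _; rewrite [in RHS](bigD1 k)//= eqxx mulrC mulrCA.
by congr (_ * (_ * _)); apply: eq_bigr => i /negbTE ->.
Qed.

Lemma sep_mean_swap (lam mu : (R -> R) -> R) f th (k l : 'I_m) :
  is_mean lam -> is_mean mu -> sep f -> k != l ->
  lam (fun y => mu (fun x => f (upd (upd th l y) k x))) =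
  mu (fun x => lam (fun y => f (upd (upd th k x) l y))).
Proof.
move=> hl hm [J [a [t [ct ->]]]] kl.
have E x y : \sum_j a j * \prod_i t j i (upd (upd th l y) k x i) =
    \sum_j (a j * \prod_(i | (i != k) && (i != l)) t j i (th i)) * t j k x * t j l y.
  apply: eq_bigr => j _; rewrite prod_upd (bigD1 l)/=; last by rewrite eq_sym.
  rewrite upd_same -2!mulrA; congr (_ * _).
  rewrite [RHS]mulrC mulrA; congr (_ * _); apply: eq_bigr => i /andP[_ il].
  by rewrite upd_diff.
under eq_fun do under eq_fun do rewrite E.
under [in RHS]eq_fun do under eq_fun do rewrite updC// E.
exact: (@mean_swap _ lam mu J
  (fun j => a j * \prod_(i | (i != k) && (i != l)) t j i (th i))
  (fun j => t j k) (fun j => t j l)).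
Qed.

(** The functional may change with the coordinate, so that one coordinate can carry the weighted
    mean while the others stay uniform. The head of the list is the outermost mean. *)
Fixpoint lavg (lam : 'I_m -> (R -> R) -> R) (s : seq 'I_m) f th : R :=
  match s with
  | [::] => f th
  | k :: s' => lam k (fun x => lavg lam s' f (upd th k x))
  end.

Lemma iavg_lavg (phi : 'I_m -> R) (r : R) s f th :
  Defs.iavg phi r s f th = lavg (fun k => umean (phi k) r) s f th.
Proof.
elim: s th => //= k s IH th.
by congr (_ * Rintegral _ _ _); apply/funext => x; rewrite IH.
Qed.

Section Lavg.
Variables (lam : 'I_m -> (R -> R) -> R) (hlam : forall k, is_mean (lam k)).

Lemma sep_lavg s f : sep f -> sep (lavg lam s f).
Proof. by move=> sf; elim: s => //= k s IH; exact: sep_mean. Qed.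

Lemma lavg_lin s (a : R) f g th : sep f -> sep g ->
  lavg lam s (fun t => a * f t + g t) th = a * lavg lam s f th + lavg lam s g th.
Proof.
move=> sf sg; elim: s th => //= k s IH th.
under eq_fun do rewrite IH.
by rewrite (mean_lin (hlam k))//; apply: sep_line; exact: sep_lavg.
Qed.

Lemma lavg_cst s (a : R) th : lavg lam s (fun=> a) th = a.
Proof.
elim: s th => //= k s IH th.
by under eq_fun do rewrite IH; exact: (mean_cst (hlam k)).
Qed.

Lemma lavgZ s (a : R) f th : sep f ->
  lavg lam s (fun t => a * f t) th = a * lavg lam s f th.
Proof.
move=> sf; have := lavg_lin s a th sf (sep_cst 0).
by rewrite lavg_cst addr0 => <-; under [in RHS]eq_fun do rewrite addr0.
Qed.

Lemma lavgD s f g th : sep f -> sep g ->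
  lavg lam s (fun t => f t + g t) th = lavg lam s f th + lavg lam s g th.
Proof.
move=> sf sg; have := lavg_lin s 1 th sf sg.
by rewrite mul1r => <-; under [in RHS]eq_fun do rewrite mul1r.
Qed.

Lemma lavgB s f g th : sep f -> sep g ->
  lavg lam s (fun t => f t - g t) th = lavg lam s f th - lavg lam s g th.
Proof.
move=> sf sg; rewrite -mulN1r -lavgZ// -lavgD//; last exact: sepZ.
by under [in RHS]eq_fun do rewrite mulN1r.
Qed.

Lemma lavg_sum s (I : Type) (e : seq I) (P : pred I) (F : I -> ('I_m -> R) -> R) th :
  (forall i, sep (F i)) ->
  lavg lam s (fun t => \sum_(i <- e | P i) F i t) th = \sum_(i <- e | P i) lavg lam s (F i) th.
Proof.
move=> sF; elim: e => [|i e IH].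
  by under eq_fun do rewrite big_nil; rewrite big_nil lavg_cst.
under eq_fun do rewrite big_cons.
by rewrite big_cons; case: (P i) => //; rewrite lavgD ?IH//; exact: sep_sum.
Qed.

(** Only the coordinates in [s] move, so the comparison is required only where the others keep their
    value in [th]. This localization is what holds the earlier coordinates at [phi] in
    [lavg_telescope]. *)
Lemma lavg_le s f g th : sep f -> sep g ->
  (forall t, (forall i, i \notin s -> t i = th i) -> f t <= g t) ->
  lavg lam s f th <= lavg lam s g th.
Proof.
move=> sf sg; elim: s th => [|k s IH] th fg /=; first exact: fg.
apply: (mean_le (hlam k)); [exact: sep_line (sep_lavg _ _)|exact: sep_line (sep_lavg _ _)|].
move=> x; apply: IH => t tE; apply: fg => i; rewrite inE negb_or => /andP[ik is_].
by rewrite tE// upd_diff.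
Qed.

Lemma lavg_norm_le s f th (B : R) : sep f ->
  (forall t, (forall i, i \notin s -> t i = th i) -> `|f t| <= B) ->
  `|lavg lam s f th| <= B.
Proof.
move=> sf fB; rewrite ler_norml; apply/andP; split.
  rewrite -(lavg_cst s (- B) th); apply: lavg_le => //; first exact: sep_cst.
  by move=> t /fB; rewrite ler_norml => /andP[].
rewrite -[leRHS](lavg_cst s B th); apply: lavg_le => //; first exact: sep_cst.
by move=> t /fB; rewrite ler_norml => /andP[].
Qed.

Lemma lavg_mean_comm (mu : (R -> R) -> R) s f th (k : 'I_m) :
  is_mean mu -> sep f -> k \notin s ->
  lavg lam s (fun t => mu (fun x => f (upd t k x))) th =
  mu (fun x => lavg lam s f (upd th k x)).
Proof.
move=> hm sf; elim: s th => //= l s IH th; rewrite inE negb_or => /andP[kl ks].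
under eq_fun do rewrite IH//.
by rewrite sep_mean_swap//; exact: sep_lavg.
Qed.

(** Means over distinct coordinates commute, so the one over [l] can be made innermost, where the
    one-variable identities for [leg2] apply. *)
Lemma lavg_rem s f th (l : 'I_m) : sep f -> uniq s -> l \in s ->
  lavg lam s f th = lavg lam (rem l s) (fun t => lam l (fun x => f (upd t l x))) th.
Proof.
move=> sf; elim: s th => //= k s IH th /andP[ks us]; rewrite inE.
have [<- _|kl] := eqVneq k l; first by rewrite (lavg_mean_comm _ (hlam k)).
move=> ls.
by congr (lam k); apply/funext => x; rewrite IH.
Qed.

(** Induction on the increasing list. Its head [k] precedes the coordinates of the tail, so the
    increment due to averaging [k] is itself averaged over later coordinates only: [B k] has to work
    for arbitrary later coordinates, with those up to [k] at [phi]. *)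
Lemma lavg_telescope s f (phi : 'I_m -> R) (B : 'I_m -> R) : sep f ->
  pairwise (fun i j : 'I_m => (i < j)%N) s ->
  (forall (k : 'I_m) th, (forall i : 'I_m, (i < k)%N -> th i = phi i) -> th k = phi k ->
     `|lam k (fun x => f (upd th k x)) - f th| <= B k) ->
  `|lavg lam s f phi - f phi| <= \sum_(k <- s) B k.
Proof.
move=> sf; elim: s => [|k s IH] /=; first by rewrite subrr normr0 big_nil.
move=> /andP[ks ss] HB; rewrite big_cons.
have kns : k \notin s.
  by apply/negP => /(allP ks); rewrite ltnn.
(* With the mean over [k] innermost, the difference splits into the average over [s] of the
   increment [h - f] and the difference of the induction hypothesis. *)
rewrite -(lavg_mean_comm _ (hlam k))//.
set h := fun t => lam k _.
have sh : sep h by exact: (@sep_mean (lam k) f k (hlam k) sf).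
have -> : lavg lam s h phi - f phi =
   lavg lam s (fun t => h t - f t) phi + (lavg lam s f phi - f phi).
  by rewrite lavgB// addrA subrK.
rewrite (le_trans (ler_normD _ _))// lerD//; last exact: IH.
apply: lavg_norm_le; first exact: sepB.
move=> t tE; apply: HB; last exact: tE.
move=> i ik; apply: tE; apply/negP => /(allP ks); rewrite ltnNge.
by rewrite (ltnW ik).
Qed.

End Lavg.

End Separable.

(** * Uniform and weighted means on an interval *)

Section Calculus.
Variable R : realType.
Implicit Types (f g : R -> R) (a r x y : R).

Lemma is_deriveD_fun f g x (df dg : R) : is_derive x 1 f df -> is_derive x 1 g dg ->
  is_derive x 1 (fun y => f y + g y) (df + dg).
Proof. exact: is_deriveD. Qed.

Lemma is_deriveM_fun f g x (df dg : R) : is_derive x 1 f df -> is_derive x 1 g dg ->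
  is_derive x 1 (fun y => f y * g y) (df * g x + f x * dg).
Proof.
move=> hf hg; apply: (is_derive_eq (is_deriveM hf hg)).
by rewrite /GRing.scale/= addrC [g x * _]mulrC.
Qed.

Lemma is_deriveZ_fun (c : R) f x (df : R) : is_derive x 1 f df ->
  is_derive x 1 (fun y => c * f y) (c * df).
Proof.
move=> hf; apply: (is_derive_eq (is_deriveM_fun (is_derive_cst c x 1) hf)).
by rewrite mul0r add0r.
Qed.

Lemma is_derive_pow_shift a x (n : nat) :
  is_derive x 1 (fun y => (y - a) ^+ n.+1) (n.+1%:R * (x - a) ^+ n).
Proof.
have h : is_derive x 1 (fun y => y - a) 1.
  have := is_deriveD_fun (is_derive_id x 1) (is_derive_cst (- a) x 1).
  by rewrite addr0.
elim: n => [|n IH]; first by rewrite mulr1; under eq_fun do rewrite expr1.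
under eq_fun do rewrite exprS.
apply: (is_derive_eq (is_deriveM_fun h IH)).
by rewrite mul1r mulrCA -exprS -[in RHS]natr1 mulrDl mul1r addrC.
Qed.

Lemma is_derive_continuous f (df : R -> R) : (forall x, is_derive x 1 f (df x)) ->
  continuous f.
Proof.
by move=> hf x; apply: differentiable_continuous; apply/derivable1_diffP; case: (hf x).
Qed.

Lemma umean_FTC a r F f : 0 < r -> continuous f -> (forall x, is_derive x 1 F (f x)) ->
  umean a r f = (2 * r)^-1 * (F (a + r) - F (a - r)).
Proof.
move=> r0 cf hF; rewrite /umean; congr (_ * _).
have ar : a - r < a + r by lra.
have cF := is_derive_continuous hF.
rewrite /Rintegral (@continuous_FTC2 _ f F)//.
- exact: continuous_subspaceT.
- split.
  + by move=> x _; case: (hF x).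
  + by apply: cvg_at_right_filter; exact: cF.
  + by apply: cvg_at_left_filter; exact: cF.
- by move=> x _; rewrite derive1E; case: (hF x).
Qed.

Lemma continuous_integrable_itv f a b : continuous f ->
  (@lebesgue_measure R).-integrable `[a, b] (EFin \o f).
Proof.
move=> cf; apply: continuous_compact_integrable; first exact: segment_compact.
exact: continuous_subspaceT.
Qed.

Lemma umean_is_mean a r : 0 < r -> is_mean (umean a r).
Proof.
move=> r0; split.
- move=> c f g cf cg; rewrite /umean RintegralD//; last 2 first.
  + by apply: continuous_integrable_itv; apply: continuous_mul => //; exact: continuous_cst.
  + exact: continuous_integrable_itv.
  rewrite RintegralZl//; last exact: continuous_integrable_itv.
  by rewrite mulrDr mulrCA.
- move=> f cf f0; rewrite /umean mulr_ge0//; first by rewrite invr_ge0 mulr_ge0// ltW.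
  by apply: Rintegral_ge0.
- rewrite (@umean_FTC a r id)//; last exact: continuous_cst.
  by field; rewrite gt_eqF.
Qed.

Lemma continuous_shift_pow a (n : nat) : continuous (fun x : R => (x - a) ^+ n).
Proof.
case: n => [|n]; first exact: continuous_cst.
exact: is_derive_continuous (is_derive_pow_shift a ^~ n).
Qed.

(** Odd powers cancel by symmetry about [a]. Degree 6 is the largest that occurs: [bump4] times the
    square in [wmean_shift2]. *)
Lemma umean_poly a r (c : nat -> R) : 0 < r ->
  umean a r (fun x => \sum_(i < 7) c i * (x - a) ^+ i) =
  c 0%N + c 2%N * (r ^+ 2 / 3) + c 4%N * (r ^+ 4 / 5) + c 6%N * (r ^+ 6 / 7).
Proof.
move=> r0.
rewrite (mean_sum (umean_is_mean a r0)); last by move=> i; exact: continuous_shift_pow.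
have M (n : nat) : umean a r (fun x => (x - a) ^+ n) =
    (2 * r)^-1 * (n.+1%:R^-1 * (r ^+ n.+1 - (- r) ^+ n.+1)).
  have hF x : is_derive x 1 (fun x => n.+1%:R^-1 * (x - a) ^+ n.+1) ((x - a) ^+ n).
    apply: (is_derive_eq (is_deriveZ_fun _ (is_derive_pow_shift a x n))).
    by rewrite mulrA mulVf ?mul1r// pnatr_eq0.
  rewrite (umean_FTC a r0 (@continuous_shift_pow a n) hF).
  have -> : a + r - a = r by ring.
  have -> : a - r - a = - r by ring.
  by rewrite -mulrBr.
under eq_bigr do rewrite M.
rewrite !big_ord_recr big_ord0 /=.
by field; rewrite gt_eqF.
Qed.

Definition leg2 a r x : R := (x - a) ^+ 2 - r ^+ 2 / 3.
Definition bump4 a r x : R := 12^-1 * ((x - a) ^+ 2 - r ^+ 2) ^+ 2.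

(** The prefactor normalizes the weight: the uniform mean of [bump4] is r^4 (1/5 - 2/3 + 1)/12 = 2
    r^4/45. *)
Definition wmean a r (u : R -> R) : R :=
  45 / (2 * r ^+ 4) * umean a r (fun x => bump4 a r x * u x).

(** Two uses of the mean value theorem on each side of [a]: the first derivative has the sign of its
    distance to the critical point [a]. *)
Lemma is_derive_convex_ge f (f1 f2 : R -> R) a x :
  (forall y, is_derive y 1 f (f1 y)) -> (forall y, is_derive y 1 f1 (f2 y)) ->
  (forall y, 0 <= f2 y) -> f1 a = 0 -> f a <= f x.
Proof.
move=> h1 h2 f20 f1a.
have c1 := is_derive_continuous h1; have c2 := is_derive_continuous h2.
have [ax|xa] := leP a x.
  have [c] := MVT_segment ax (fun y _ => h1 y) (continuous_subspaceT c1).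
  rewrite in_itv/= => /andP[ac cx] E1.
  have [d _] := MVT_segment ac (fun y _ => h2 y) (continuous_subspaceT c2).
  rewrite f1a subr0 => E2.
  by rewrite -subr_ge0 E1 E2 !mulr_ge0// subr_ge0.
have [c] := MVT_segment (ltW xa) (fun y _ => h1 y) (continuous_subspaceT c1).
rewrite in_itv/= => /andP[xc ca] E1.
have [d _] := MVT_segment ca (fun y _ => h2 y) (continuous_subspaceT c2).
rewrite f1a sub0r => E2.
rewrite -subr_le0 E1; have -> : f1 c = - (f2 d * (a - c)) by rewrite -E2 opprK.
by rewrite mulNr oppr_le0 !mulr_ge0// subr_ge0// ltW.
Qed.

Lemma taylor2_le f (f1 f2 : R -> R) a (D : R) x :
  (forall y, is_derive y 1 f (f1 y)) -> (forall y, is_derive y 1 f1 (f2 y)) ->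
  (forall y, `|f2 y| <= D) ->
  `|f x - f a - f1 a * (x - a)| <= D / 2 * (x - a) ^+ 2.
Proof.
move=> h1 h2 f2D.
have key (e : R) : `|e| = 1 ->
    0 <= D / 2 * (x - a) ^+ 2 + e * (f x - f a - f1 a * (x - a)).
  move=> e1.
  (* The second derivative of [g] is [D + e * f2], nonnegative for both signs [e], and its slope at
     [a] is zero; its minimality at [a] gives one side of the Taylor estimate for each sign. The
     exponent 1 is kept to match [is_derive_pow_shift]. *)
  pose g y := D / 2 * (y - a) ^+ 2 + e * (f y + (- f1 a) * (y - a) ^+ 1).
  pose g1 y := D * (y - a) ^+ 1 + e * (f1 y + - f1 a).
  have hg y : is_derive y 1 g (g1 y).
    apply: (is_derive_eq (is_deriveD_fun (is_deriveZ_fun _ (is_derive_pow_shift a y 1))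
      (is_deriveZ_fun e (is_deriveD_fun (h1 y) (is_deriveZ_fun _ (is_derive_pow_shift a y 0)))))).
    by rewrite /g1; field.
  have hg1 y : is_derive y 1 g1 (D + e * f2 y).
    apply: (is_derive_eq (is_deriveD_fun (is_deriveZ_fun _ (is_derive_pow_shift a y 0))
      (is_deriveZ_fun e (is_deriveD_fun (h2 y) (is_derive_cst _ y 1))))).
    by ring.
  have := @is_derive_convex_ge g g1 (fun y => D + e * f2 y) a x hg hg1.
  have -> : g1 a = 0 by rewrite /g1; ring.
  have H0 y : 0 <= D + e * f2 y.
    have : `|e * f2 y| <= D by rewrite normrM e1 mul1r.
    by rewrite ler_norml => /andP[? _]; lra.
  move=> /(_ H0 erefl); rewrite /g subrr.
  by move=> h; lra.
have := key 1 (normr1 _); have := key (-1) (normrN1 _).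
by rewrite ler_norml => ? ?; apply/andP; split; lra.
Qed.

(** The mean is centred at [a], so the linear Taylor term averages to zero and only the quadratic
    remainder, weighted by the variance [v], is left. *)
Lemma mean_taylor (lam : (R -> R) -> R) a (v : R) f (f1 f2 : R -> R) (D : R) :
  is_mean lam -> lam (fun x => (x - a) ^+ 1) = 0 -> lam (fun x => (x - a) ^+ 2) = v ->
  (forall y, is_derive y 1 f (f1 y)) -> (forall y, is_derive y 1 f1 (f2 y)) ->
  (forall y, `|f2 y| <= D) ->
  `|lam f - f a| <= D / 2 * v.
Proof.
move=> hl l1 l2 h1 h2 f2D.
have cf := is_derive_continuous h1.
have cp n := @continuous_shift_pow a n.
have L (e : R) : lam (fun x => e * (x - a) ^+ 2 + (f1 a * (x - a) ^+ 1 + f a)) =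
    e * v + f a.
  rewrite (mean_lin hl); last 2 first.
  - exact: cp.
  - apply: continuous_add; last exact: continuous_cst.
    by apply: continuous_mul; [exact: continuous_cst|exact: cp].
  rewrite l2 (mean_lin hl); last 2 first.
  - exact: cp.
  - exact: continuous_cst.
  by rewrite l1 mulr0 add0r (mean_cst hl).
have cL e : continuous (fun x => e * (x - a) ^+ 2 + (f1 a * (x - a) ^+ 1 + f a)).
  apply: continuous_add.
    by apply: continuous_mul; [exact: continuous_cst|exact: cp].
  apply: continuous_add; last exact: continuous_cst.
  by apply: continuous_mul; [exact: continuous_cst|exact: cp].
have T x := taylor2_le a x h1 h2 f2D.
rewrite ler_norml; apply/andP; split.
  have : lam (fun x => - (D / 2) * (x - a) ^+ 2 + (f1 a * (x - a) ^+ 1 + f a)) <= lam f.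
    apply: (mean_le hl) => // x; have := T x; rewrite ler_norml => /andP[? _]; lra.
  by rewrite L => ?; lra.
have : lam f <= lam (fun x => (D / 2) * (x - a) ^+ 2 + (f1 a * (x - a) ^+ 1 + f a)).
  apply: (mean_le hl) => // x; have := T x; rewrite ler_norml => /andP[_ ?]; lra.
by rewrite L => ?; lra.
Qed.

(** The coefficients form a list because its [nth] is 0 beyond the end: a polynomial of low degree
    is given by a short list. *)
Lemma umean_poly_ext a r (c : seq R) (u : R -> R) : 0 < r ->
  (forall x, u x = \sum_(i < 7) c`_i * (x - a) ^+ i) ->
  umean a r u = c`_0 + c`_2 * (r ^+ 2 / 3) + c`_4 * (r ^+ 4 / 5) + c`_6 * (r ^+ 6 / 7).
Proof. by move=> r0 /funext ->; rewrite umean_poly. Qed.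

Lemma umean_shift1 a r : 0 < r -> umean a r (fun x => (x - a) ^+ 1) = 0.
Proof.
move=> r0; rewrite (@umean_poly_ext _ _ [:: 0; 1])//=; first by ring.
by move=> x; rewrite !big_ord_recr big_ord0 /=; ring.
Qed.

Lemma umean_shift2 a r : 0 < r -> umean a r (fun x => (x - a) ^+ 2) = r ^+ 2 / 3.
Proof.
move=> r0; rewrite (@umean_poly_ext _ _ [:: 0; 0; 1])//=; first by ring.
by move=> x; rewrite !big_ord_recr big_ord0 /=; ring.
Qed.

Lemma umean_leg2 a r : 0 < r -> umean a r (leg2 a r) = 0.
Proof.
move=> r0; rewrite (@umean_poly_ext _ _ [:: - (r ^+ 2 / 3); 0; 1])//=; first by ring.
by move=> x; rewrite !big_ord_recr big_ord0 /leg2 /=; ring.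
Qed.

Lemma umean_leg2_sqr a r : 0 < r ->
  umean a r (fun x => leg2 a r x * leg2 a r x) = 4 * r ^+ 4 / 45.
Proof.
move=> r0.
rewrite (@umean_poly_ext _ _ [:: r ^+ 4 / 9; 0; - (2 * r ^+ 2 / 3); 0; 1])//=.
  by field.
by move=> x; rewrite !big_ord_recr big_ord0 /leg2 /=; field.
Qed.

Lemma continuous_leg2 a r : continuous (leg2 a r).
Proof. by apply: continuous_add; [exact: continuous_shift_pow|exact: continuous_cst]. Qed.

Lemma continuous_bump4 a r : continuous (bump4 a r).
Proof.
apply: continuous_mul; first exact: continuous_cst.
have c : continuous (fun x : R => (x - a) ^+ 2 - r ^+ 2).
  by apply: continuous_add; [exact: continuous_shift_pow|exact: continuous_cst].
by under eq_fun do rewrite expr2; exact: continuous_mul.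
Qed.

Lemma wmean_is_mean a r : 0 < r -> is_mean (wmean a r).
Proof.
move=> r0; have hu := umean_is_mean a r0; have cb := @continuous_bump4 a r.
split.
- move=> c f g cf cg; rewrite /wmean.
  have -> : (fun x => bump4 a r x * (c * f x + g x)) =
            (fun x => c * (bump4 a r x * f x) + bump4 a r x * g x).
    by apply/funext => x; ring.
  by rewrite (mean_lin hu); [ring|exact: continuous_mul|exact: continuous_mul].
- move=> f cf f0; rewrite /wmean mulr_ge0//.
    by rewrite mulr_ge0// invr_ge0 mulr_ge0// exprn_ge0// ltW.
  apply: (mean_ge0 hu); first exact: continuous_mul.
  by move=> x; rewrite mulr_ge0// /bump4 mulr_ge0// sqr_ge0.
- rewrite /wmean (@umean_poly_ext _ _ [:: r ^+ 4 / 12; 0; - (r ^+ 2 / 6); 0; 12^-1])//=.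
    by field; rewrite gt_eqF.
  by move=> x; rewrite !big_ord_recr big_ord0 /bump4 /=; field.
Qed.

Lemma wmean_shift1 a r : 0 < r -> wmean a r (fun x => (x - a) ^+ 1) = 0.
Proof.
move=> r0; rewrite /wmean.
rewrite (@umean_poly_ext _ _ [:: 0; r ^+ 4 / 12; 0; - (r ^+ 2 / 6); 0; 12^-1])//=.
  by ring.
by move=> x; rewrite !big_ord_recr big_ord0 /bump4 /=; field.
Qed.

Lemma wmean_shift2 a r : 0 < r -> wmean a r (fun x => (x - a) ^+ 2) = r ^+ 2 / 7.
Proof.
move=> r0; rewrite /wmean.
rewrite (@umean_poly_ext _ _ [:: 0; 0; r ^+ 4 / 12; 0; - (r ^+ 2 / 6); 0; 12^-1])//=.
  by field; rewrite gt_eqF.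
by move=> x; rewrite !big_ord_recr big_ord0 /bump4 /=; field.
Qed.

(* [bump4] is the second antiderivative of [leg2] that vanishes to first order at both
   ends of the interval, so integrating by parts twice leaves no boundary term. *)
Lemma umean_leg2_parts a r f (f1 f2 : R -> R) : 0 < r ->
  (forall y, is_derive y 1 f (f1 y)) -> (forall y, is_derive y 1 f1 (f2 y)) ->
  continuous f2 ->
  umean a r (fun x => f x * leg2 a r x) = 2 * r ^+ 4 / 45 * wmean a r f2.
Proof.
move=> r0 h1 h2 c2; have hu := umean_is_mean a r0.
have cf := is_derive_continuous h1.
pose B1 x := 3^-1 * (((x - a) ^+ 2 + - r ^+ 2) * (x - a) ^+ 1).
have hB x : is_derive x 1 (bump4 a r) (B1 x).
  have h : is_derive x 1 (fun y => (y - a) ^+ 2 + - r ^+ 2) (2 * (x - a) ^+ 1).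
    apply: (is_derive_eq (is_deriveD_fun (is_derive_pow_shift a x 1) (is_derive_cst _ _ _))).
    by rewrite addr0.
  rewrite /bump4; under eq_fun do rewrite expr2.
  apply: (is_derive_eq (is_deriveZ_fun (12^-1) (is_deriveM_fun h h))).
  by rewrite /B1; field.
have hB1 x : is_derive x 1 B1 (leg2 a r x).
  have h : is_derive x 1 (fun y => (y - a) ^+ 2 + - r ^+ 2) (2 * (x - a) ^+ 1).
    apply: (is_derive_eq (is_deriveD_fun (is_derive_pow_shift a x 1) (is_derive_cst _ _ _))).
    by rewrite addr0.
  apply: (is_derive_eq (is_deriveZ_fun (3^-1)
    (is_deriveM_fun h (is_derive_pow_shift a x 0)))).
  by rewrite /leg2; field.
pose F x := f x * B1 x + (- 1) * (f1 x * bump4 a r x).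
have hF x : is_derive x 1 F (f x * leg2 a r x + (- 1) * (bump4 a r x * f2 x)).
  apply: (is_derive_eq (is_deriveD_fun (is_deriveM_fun (h1 x) (hB1 x))
    (is_deriveZ_fun (- 1) (is_deriveM_fun (h2 x) (hB x))))).
  by ring.
have c0 : continuous (fun x => bump4 a r x * f2 x).
  by apply: continuous_mul => //; exact: continuous_bump4.
have c1 : continuous (fun x => f x * leg2 a r x).
  by apply: continuous_mul => //; exact: continuous_leg2.
have c3 : continuous (fun x => (- 1) * (bump4 a r x * f2 x)).
  by apply: continuous_mul => //; exact: continuous_cst.
have := umean_FTC a r0 (continuous_add c1 c3) hF.
rewrite (meanD hu)// (meanZ hu)//.
have -> : F (a + r) - F (a - r) = 0 by rewrite /F /B1 /bump4; ring.
rewrite mulr0 mulN1r => /eqP; rewrite subr_eq0 => /eqP ->.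
by rewrite /wmean; field; rewrite gt_eqF.
Qed.

End Calculus.

(** * Adjoints and spectral decomposition *)

Section Complex.
Variable R : realType.
Implicit Types x y : R[i].

Lemma cReM x y : complex.Re (x * y) =
  complex.Re x * complex.Re y - complex.Im x * complex.Im y.
Proof. by case: x => a b; case: y => c d. Qed.

Lemma cImM x y : complex.Im (x * y) =
  complex.Re x * complex.Im y + complex.Im x * complex.Re y.
Proof. by case: x => a b; case: y => c d. Qed.

Lemma cReD x y : complex.Re (x + y) = complex.Re x + complex.Re y.
Proof. by case: x => a b; case: y. Qed.

Lemma cImD x y : complex.Im (x + y) = complex.Im x + complex.Im y.
Proof. by case: x => a b; case: y. Qed.

Lemma Re_sum (I : Type) (s : seq I) (P : pred I) (F : I -> R[i]) :
  complex.Re (\sum_(i <- s | P i) F i) = \sum_(i <- s | P i) complex.Re (F i).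
Proof. exact: (big_morph _ cReD). Qed.

Lemma Im_sum (I : Type) (s : seq I) (P : pred I) (F : I -> R[i]) :
  complex.Im (\sum_(i <- s | P i) F i) = \sum_(i <- s | P i) complex.Im (F i).
Proof. exact: (big_morph _ cImD). Qed.

Lemma sqr_normc_ReIm x :
  ComplexField.Normc.normc x ^+ 2 = complex.Re x ^+ 2 + complex.Im x ^+ 2.
Proof. by case: x => a b /=; rewrite sqr_sqrtr// addr_ge0// sqr_ge0. Qed.

Lemma normc_ge0 x : 0 <= ComplexField.Normc.normc x.
Proof. by case: x => a b /=; rewrite sqrtr_ge0. Qed.

Lemma normc_realc (a : R) : ComplexField.Normc.normc (a%:C)%C = `|a|.
Proof. by rewrite /= expr0n addr0 sqrtr_sqr. Qed.

Lemma Re_conj_mul x : complex.Re (conjc x * x) = ComplexField.Normc.normc x ^+ 2.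
Proof. by rewrite sqr_normc_ReIm; case: x => a b /=; ring. Qed.

Lemma Re_le_normc x : `|complex.Re x| <= ComplexField.Normc.normc x.
Proof.
rewrite -(@ler_pXn2r _ 2)// ?nnegrE ?normc_ge0//.
by rewrite sqr_normc_ReIm real_normK ?num_real// lerDl sqr_ge0.
Qed.

Lemma normc_conj x : ComplexField.Normc.normc (conjc x) = ComplexField.Normc.normc x.
Proof. by case: x => a b /=; rewrite sqrrN. Qed.

End Complex.

Section Adjoint.
Variable R : realType.

Lemma adjM p q s (A : 'M[R[i]]_(p, q)) (B : 'M[R[i]]_(q, s)) :
  adj (A *m B) = adj B *m adj A.
Proof. by rewrite /adj map_mxM trmx_mul. Qed.

Lemma adjK p q (A : 'M[R[i]]_(p, q)) : adj (adj A) = A.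
Proof. by apply/matrixP => i j; rewrite !mxE conjcK. Qed.

Lemma adj_1mx d : adj (1%:M : 'M[R[i]]_d) = 1%:M.
Proof. by rewrite /adj map_mx1 trmx1. Qed.

Lemma adj_diag d (v : 'rV[R[i]]_d) : adj (diag_mx v) = diag_mx (map_mx conjc v).
Proof. by rewrite /adj map_diag_mx tr_diag_mx. Qed.

Lemma unitary_adj d (U : 'M[R[i]]_d) : unitary U -> unitary (adj U).
Proof. by move=> [U1 U2]; split; rewrite adjK. Qed.

Lemma hermitian_spectral d (H : 'M[R[i]]_d) : is_hermitian H ->
  exists (P : 'M[R[i]]_d) (lam : 'I_d -> R), unitary P /\
    H = adj P *m diag_mx (\row_k (lam k)%:C%C) *m P.
Proof.
move=> hH.
have Hh : H \is hermsymmx.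
  by apply/is_hermitianmxP; rewrite expr0 scale1r; apply/matrixP => i j; rewrite -[in LHS]hH !mxE.
have uP := spectral_unitarymx H.
have aP : adj (spectralmx H) = invmx (spectralmx H) by rewrite invmx_unitary// /adj map_trmx.
have /orthomx_spectralP HE := hermitian_normalmx Hh.
have /mxOverP dr := hermitian_spectral_diag_real Hh.
exists (spectralmx H), (fun k => complex.Re (spectral_diag H 0 k)); split.
  by split; rewrite aP ?mulmxV ?mulVmx// unitarymx_unit.
rewrite aP [LHS]HE; congr (_ *m diag_mx _ *m _).
apply/rowP => k; rewrite !mxE; exact/esym/RRe_real/dr.
Qed.

End Adjoint.

(** * Vector and operator norms *)

Local Notation normc := ComplexField.Normc.normc.

Section VectorNorm.
Variable R : realType.

Lemma cauchy_schwarz_sum (I : finType) (a b : I -> R) :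
  \sum_i a i * b i <= Num.sqrt (\sum_i a i ^+ 2) * Num.sqrt (\sum_i b i ^+ 2).
Proof.
set A := \sum_i a i ^+ 2; set B := \sum_i b i ^+ 2.
have A0 : 0 <= A by apply: sumr_ge0 => i _; exact: sqr_ge0.
have B0 : 0 <= B by apply: sumr_ge0 => i _; exact: sqr_ge0.
have zero (c : I -> R) i : \sum_i c i ^+ 2 = 0 -> c i = 0.
  move=> /eqP; rewrite psumr_eq0 => [/allP/(_ i)|j _]; last exact: sqr_ge0.
  by rewrite mem_index_enum sqrf_eq0 => /(_ isT)/eqP.
have [A00|An0] := eqVneq A 0.
  by rewrite A00 sqrtr0 mul0r big1// => i _; rewrite (zero a i A00) mul0r.
have [B00|Bn0] := eqVneq B 0.
  by rewrite B00 sqrtr0 mulr0 big1// => i _; rewrite (zero b i B00) mulr0.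
have sA : 0 < Num.sqrt A by rewrite sqrtr_gt0 lt_neqAle eq_sym An0.
have sB : 0 < Num.sqrt B by rewrite sqrtr_gt0 lt_neqAle eq_sym Bn0.
(* This sum of squares expands to 2 A B - 2 s times the sum of the [a i * b i], where s is the
   product of the two roots and s^2 = A B; dividing by 2 s > 0 concludes. *)
have : 0 <= \sum_i (Num.sqrt B * a i - Num.sqrt A * b i) ^+ 2.
  by apply: sumr_ge0 => i _; exact: sqr_ge0.
have -> : \sum_i (Num.sqrt B * a i - Num.sqrt A * b i) ^+ 2 =
    Num.sqrt B ^+ 2 * A + Num.sqrt A ^+ 2 * B -
      2 * (Num.sqrt A * Num.sqrt B) * \sum_i a i * b i.
  rewrite !mulr_sumr -sumrN -!big_split/=; apply: eq_bigr => i _; ring.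
rewrite !sqr_sqrtr// => h.
have := mulr_gt0 sA sB; set s := _ * _ => s0.
have E : A * B = s ^+ 2 by rewrite exprMn !sqr_sqrtr.
rewrite -(ler_pM2l (mulr_gt0 (ltr0Sn R 1) s0)).
rewrite [leRHS](_ : _ = B * A + A * B); first by rewrite -subr_ge0.
by rewrite (mulrC B) E; ring.
Qed.

Lemma vnorm_ge0 d (v : 'cV[R[i]]_d) : 0 <= vnorm v.
Proof. exact: sqrtr_ge0. Qed.

Lemma vnorm_sqr d (v : 'cV[R[i]]_d) : vnorm v ^+ 2 = \sum_k normc (v k ord0) ^+ 2.
Proof. by rewrite sqr_sqrtr// sumr_ge0// => i _; exact: sqr_ge0. Qed.

Lemma vnorm_sqr_adj d (v : 'cV[R[i]]_d) :
  vnorm v ^+ 2 = complex.Re ((adj v *m v) ord0 ord0).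
Proof.
rewrite vnorm_sqr mxE Re_sum; apply: eq_bigr => k _.
by rewrite !mxE Re_conj_mul.
Qed.

Lemma vnorm_unitary d (U : 'M[R[i]]_d) (v : 'cV[R[i]]_d) : unitary U ->
  vnorm (U *m v) = vnorm v.
Proof.
move=> [_ U2]; apply/eqP; rewrite -(@eqrXn2 _ 2)// ?vnorm_ge0//.
by rewrite !vnorm_sqr_adj adjM mulmxA -(mulmxA (adj v)) U2 mulmx1.
Qed.

Lemma vnormD d (u v : 'cV[R[i]]_d) : vnorm (u + v) <= vnorm u + vnorm v.
Proof.
rewrite -(@ler_pXn2r _ 2)// ?nnegrE ?addr_ge0 ?vnorm_ge0// sqrrD !vnorm_sqr.
have : \sum_k normc ((u + v) k ord0) ^+ 2 <=
    \sum_k (normc (u k ord0) + normc (v k ord0)) ^+ 2.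
  apply: ler_sum => k _; rewrite ler_pXn2r ?nnegrE ?addr_ge0 ?normc_ge0//.
  by rewrite mxE le_normcD.
move=> /le_trans; apply.
under eq_bigr do rewrite sqrrD.
rewrite !big_split/= lerD2r lerD2l -mulr2n lerMn2r/=.
exact: cauchy_schwarz_sum.
Qed.

Lemma vnormN d (v : 'cV[R[i]]_d) : vnorm (- v) = vnorm v.
Proof.
congr Num.sqrt; apply: eq_bigr => k _; rewrite mxE; congr (_ ^+ 2).
by rewrite normcN.
Qed.

Lemma vnormZ d (a : R[i]) (v : 'cV[R[i]]_d) : vnorm (a *: v) = normc a * vnorm v.
Proof.
apply/eqP; rewrite -(@eqrXn2 _ 2)// ?mulr_ge0 ?vnorm_ge0 ?normc_ge0//.
rewrite exprMn !vnorm_sqr mulr_sumr; apply/eqP; apply: eq_bigr => k _.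
by rewrite mxE ComplexField.Normc.normcM exprMn.
Qed.

Lemma vnorm0_eq0 d (v : 'cV[R[i]]_d) : vnorm v = 0 -> v = 0.
Proof.
move=> v0; have := vnorm_sqr v; rewrite v0 expr0n/= => /esym/eqP.
rewrite psumr_eq0 => [/allP h|k _]; last exact: sqr_ge0.
apply/colP => k; rewrite mxE; apply: ComplexField.Normc.eq0_normc.
by have := h k (mem_index_enum _); rewrite sqrf_eq0 => /eqP.
Qed.

Lemma vnorm_diag_le d (l : 'rV[R[i]]_d) (c : R) (v : 'cV[R[i]]_d) :
  (forall k, normc (l ord0 k) <= c) -> vnorm (diag_mx l *m v) <= c * vnorm v.
Proof.
(* In dimension 0 the hypothesis is vacuous and [c] may be negative; both vectors vanish there. *)
move=> lc; have [d0|d0] := posnP d.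
  have -> : diag_mx l *m v = 0.
    by apply/colP => k; have := ltn_ord k; rewrite [X in (_ < X)%N]d0.
  have -> : v = 0 by apply/colP => k; have := ltn_ord k; rewrite [X in (_ < X)%N]d0.
  by have := vnormZ 0 (0 : 'cV[R[i]]_d); rewrite scaler0 ComplexField.Normc.normc0 mul0r => ->; rewrite mulr0.
have c0 : 0 <= c := le_trans (normc_ge0 _) (lc (Ordinal d0)).
rewrite -(@ler_pXn2r _ 2)// ?nnegrE ?mulr_ge0 ?vnorm_ge0//.
rewrite exprMn !vnorm_sqr mulr_sumr; apply: ler_sum => k _.
rewrite mul_diag_mx mxE ComplexField.Normc.normcM exprMn ler_wpM2r ?sqr_ge0//.
by rewrite ler_pXn2r ?nnegrE ?normc_ge0.
Qed.

Lemma normc_dot_le d (u v : 'cV[R[i]]_d) :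
  `|complex.Re ((adj u *m v) ord0 ord0)| <= vnorm u * vnorm v.
Proof.
rewrite mxE Re_sum; apply: le_trans (ler_norm_sum _ _ _) _.
apply: le_trans (cauchy_schwarz_sum _ _); apply: ler_sum => k _.
rewrite !mxE; apply: le_trans (Re_le_normc _) _.
by rewrite ComplexField.Normc.normcM normc_conj.
Qed.

(** The constant is the Frobenius norm. The bound makes the set in [opnorm] bounded above, so that
    its [sup] is a genuine supremum. *)
Lemma vnorm_mulmx_bound d (A : 'M[R[i]]_d) :
  exists2 C : R, 0 <= C & forall v, vnorm (A *m v) <= C * vnorm v.
Proof.
exists (Num.sqrt (\sum_k \sum_j normc (A k j) ^+ 2)) => [|v]; first exact: sqrtr_ge0.
have S0 : 0 <= \sum_k \sum_j normc (A k j) ^+ 2.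
  by apply: sumr_ge0 => k _; apply: sumr_ge0 => j _; exact: sqr_ge0.
rewrite -(@ler_pXn2r _ 2)// ?nnegrE ?mulr_ge0 ?vnorm_ge0 ?sqrtr_ge0//.
rewrite vnorm_sqr exprMn sqr_sqrtr// mulr_suml; apply: ler_sum => k _.
have T0 : 0 <= \sum_j normc (A k j) ^+ 2 by apply: sumr_ge0 => j _; exact: sqr_ge0.
rewrite -[X in _ <= X * _]sqr_sqrtr// -exprMn.
rewrite ler_pXn2r ?nnegrE ?normc_ge0 ?mulr_ge0 ?vnorm_ge0 ?sqrtr_ge0//.
apply: le_trans (cauchy_schwarz_sum _ _).
rewrite mxE; elim/big_ind2 : _ => [|x1 x2 y1 y2 h1 h2|j _].
- by rewrite ComplexField.Normc.normc0.
- by apply: le_trans (le_normcD _ _) _; exact: lerD.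
- by rewrite ComplexField.Normc.normcM.
Qed.

End VectorNorm.

Section OperatorNorm.
Variables (R : realType) (d : nat).
Implicit Types A B X U : 'M[R[i]]_d.

Let S A := [set vnorm (A *m v) | v in [set v : 'cV[R[i]]_d | vnorm v <= 1]].

Let vnorm0 : vnorm (0 : 'cV[R[i]]_d) = 0.
Proof.
by have := vnormZ 0 (0 : 'cV[R[i]]_d); rewrite scaler0 ComplexField.Normc.normc0 mul0r.
Qed.

Let S_has_sup A : has_sup (S A).
Proof.
split.
  by exists (vnorm (A *m 0)), 0 => //=; rewrite vnorm0 ler01.
have [C C0 hC] := vnorm_mulmx_bound A.
exists C => _ [v /= v1 <-]; apply: le_trans (hC v) _.
by rewrite -[leRHS]mulr1 ler_wpM2l.
Qed.

Lemma opnorm_ge0 A : 0 <= opnorm A.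
Proof.
apply: ub_le_sup; first by case: (S_has_sup A).
by exists 0 => /=; rewrite ?vnorm0 ?ler01// mulmx0 vnorm0.
Qed.

Lemma vnorm_le_opnorm A (v : 'cV[R[i]]_d) : vnorm (A *m v) <= opnorm A * vnorm v.
Proof.
have [v0|v0] := eqVneq (vnorm v) 0.
  by rewrite (vnorm0_eq0 v0) mulmx0 vnorm0 mulr0.
have vp : 0 < vnorm v by rewrite lt_neqAle eq_sym v0 vnorm_ge0.
have : vnorm (A *m ((vnorm v)^-1%:C%C *: v)) <= opnorm A.
  apply: ub_le_sup; first by case: (S_has_sup A).
  exists ((vnorm v)^-1%:C%C *: v) => //=.
  by rewrite vnormZ normc_realc ger0_norm ?invr_ge0 ?vnorm_ge0// mulVf.
rewrite -scalemxAr vnormZ normc_realc ger0_norm ?invr_ge0 ?vnorm_ge0// mulrC.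
by rewrite ler_pdivrMr.
Qed.

Lemma opnorm_le A (c : R) : (forall v, vnorm (A *m v) <= c * vnorm v) -> 0 <= c ->
  opnorm A <= c.
Proof.
move=> h c0; apply: ge_sup; first by case: (S_has_sup A).
move=> _ [v /= v1 <-]; apply: le_trans (h v) _.
by rewrite -[leRHS]mulr1 ler_wpM2l.
Qed.

Lemma opnormM A B : opnorm (A *m B) <= opnorm A * opnorm B.
Proof.
apply: opnorm_le => [v|]; last by rewrite mulr_ge0 ?opnorm_ge0.
rewrite -mulmxA; apply: le_trans (vnorm_le_opnorm _ _) _.
by rewrite -mulrA ler_wpM2l ?opnorm_ge0// vnorm_le_opnorm.
Qed.

Lemma opnormB A B : opnorm (A - B) <= opnorm A + opnorm B.
Proof.
apply: opnorm_le => [v|]; last by rewrite addr_ge0 ?opnorm_ge0.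
rewrite mulmxBl; apply: le_trans (vnormD _ _) _.
by rewrite vnormN mulrDl lerD// vnorm_le_opnorm.
Qed.

Lemma opnormZ_unit (a : R[i]) A : normc a = 1 -> opnorm (a *: A) <= opnorm A.
Proof.
move=> a1; apply: opnorm_le (opnorm_ge0 _) => v.
by rewrite -scalemxAl vnormZ a1 mul1r vnorm_le_opnorm.
Qed.

Lemma opnorm_conj U A : unitary U -> opnorm (adj U *m A *m U) = opnorm A.
Proof.
have le V B : unitary V -> opnorm (adj V *m B *m V) <= opnorm B.
  move=> hV; apply: opnorm_le (opnorm_ge0 _) => v.
  rewrite -!mulmxA vnorm_unitary; last exact: unitary_adj.
  by apply: le_trans (vnorm_le_opnorm _ _) _; rewrite vnorm_unitary.
move=> hU; apply: le_anti; rewrite (le _ _ hU) /=.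
have := le (adj U) (adj U *m A *m U) (unitary_adj hU).
case: hU => U1 U2.
by rewrite adjK !mulmxA U1 mul1mx -mulmxA U1 mulmx1.
Qed.

(** In an eigenbasis of [rho] the trace is a convex combination of expectation values of [X] in unit
    vectors, each at most the operator norm. This transfers norm bounds on derivatives of the
    evolved observable to derivatives of the loss. *)
Lemma Re_trace_density_le (rho X : 'M[R[i]]_d) : density_operator rho ->
  `|complex.Re (\tr (rho *m X))| <= opnorm X.
Proof.
move=> [hrho psd_rho tr_rho].
have [P [p [uP rhoE]]] := hermitian_spectral hrho.
have [P1 P2] := uP.
pose e k : 'cV[R[i]]_d := adj P *m delta_mx k ord0.
have ed k : adj (delta_mx k ord0 : 'cV[R[i]]_d) = delta_mx ord0 k.
  by rewrite /adj map_delta_mx trmx_delta.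
have dd (M : 'M[R[i]]_d) k : ((delta_mx ord0 k : 'rV_d) *m M *m (delta_mx k ord0 : 'cV_d)) ord0 ord0 = M k k.
  by rewrite -rowE -colE !mxE.
have e1 k : vnorm (e k) = 1.
  rewrite /e vnorm_unitary; last exact: unitary_adj.
  apply/eqP; rewrite -(@eqrXn2 _ 2)// ?vnorm_ge0// vnorm_sqr_adj ed.
  by rewrite -[delta_mx ord0 k]mulmx1 dd mxE eqxx expr1n.
have p0 k : 0 <= p k.
  have := psd_rho (e k).
  rewrite rhoE /e adjM adjK ed !mulmxA -(mulmxA _ P) P1 mulmx1 -(mulmxA _ P) P1 mulmx1.
  by rewrite dd !mxE eqxx mulr1n ler0c.
have sp : \sum_k p k = 1.
  have := congr1 (@complex.Re R) tr_rho.
  rewrite rhoE -mulmxA mxtrace_mulC -mulmxA P1 mulmx1 mxtrace_diag Re_sum.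
  by under eq_bigr do rewrite mxE.
have -> : complex.Re (\tr (rho *m X)) =
    \sum_k p k * complex.Re ((adj (e k) *m (X *m e k)) ord0 ord0).
  rewrite rhoE -!mulmxA mxtrace_mulC -!mulmxA Re_sum; apply: eq_bigr => k _.
  have -> : adj (e k) *m (X *m e k) =
      delta_mx ord0 k *m (P *m (X *m adj P)) *m delta_mx k ord0.
    by rewrite /e adjM adjK ed !mulmxA.
  rewrite dd; set M := P *m _.
  by rewrite mul_diag_mx [in LHS]mxE [(\row__ _) _ _]mxE cReM /= mul0r subr0.
apply: le_trans (ler_norm_sum _ _ _) _.
rewrite -[leRHS]mul1r -sp mulr_suml; apply: ler_sum => k _.
rewrite normrM ger0_norm// ler_wpM2l//.
apply: le_trans (normc_dot_le _ _) _.
rewrite e1 mul1r; apply: le_trans (vnorm_le_opnorm _ _) _.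
by rewrite e1 mulr1.
Qed.

End OperatorNorm.

(** * Spectral gap and matrix exponential *)

Section Spectrum.
Variables (R : realType) (d : nat).
Implicit Types (H P X : 'M[R[i]]_d) (lam : 'I_d -> R).

(** Functional calculus in the eigenbasis coded by [P]: products, adjoints and exponentials act
    entrywise on [c]. *)
Definition specmx P (c : 'I_d -> R[i]) : 'M[R[i]]_d :=
  adj P *m diag_mx (\row_k c k) *m P.

Lemma specmxM P (b c : 'I_d -> R[i]) : unitary P ->
  specmx P b *m specmx P c = specmx P (fun k => b k * c k).
Proof.
move=> [P1 _]; rewrite /specmx !mulmxA -(mulmxA _ P) P1 mulmx1 -(mulmxA (adj P)) mulmx_diag.
by congr (_ *m diag_mx _ *m _); apply/rowP => k; rewrite !mxE.
Qed.

Lemma specmx1 P : unitary P -> specmx P (fun=> 1) = 1%:M.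
Proof.
move=> [_ P2]; rewrite /specmx (_ : \row__ 1 = const_mx 1); last first.
  by apply/rowP => k; rewrite !mxE.
by rewrite diag_const_mx mulmx1.
Qed.

Lemma specmx_adj P (c : 'I_d -> R[i]) : adj (specmx P c) = specmx P (fun k => conjc (c k)).
Proof.
rewrite /specmx !adjM adjK adj_diag mulmxA; congr (_ *m diag_mx _ *m _).
by apply/rowP => k; rewrite !mxE.
Qed.

Lemma specmx_unitary P (c : 'I_d -> R[i]) : unitary P ->
  (forall k, conjc (c k) * c k = 1) -> unitary (specmx P c).
Proof.
move=> uP c1; split; rewrite specmx_adj specmxM// -[RHS](specmx1 uP).
  by congr specmx; apply/funext => k; rewrite mulrC.
by congr specmx; apply/funext => k.
Qed.

(** The expansion in rank-one spectral projectors makes the dependence on [c] visibly linear, so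
    sums and limits pass to the coefficients. *)
Lemma specmx_sum P (c : 'I_d -> R[i]) :
  specmx P c = \sum_k c k *: (adj P *m delta_mx k k *m P).
Proof.
rewrite /specmx diag_mx_sum_delta mulmx_sumr mulmx_suml; apply: eq_bigr => k _.
by rewrite mxE -scalemxAr -scalemxAl.
Qed.

Lemma eigenvalue_specmx P lam (x : R) : unitary P ->
  eigenvalue (specmx P (fun k => (lam k)%:C%C)) x%:C%C <-> exists k, x = lam k.
Proof.
move=> [P1 P2]; split.
  move=> /eigenvalueP[v vE v0].
  (* Eigenvectors are row vectors here. In the coordinates [u] the equation is diagonal, and a
     nonzero entry of [u] singles out the eigenvalue. *)
  pose u := v *m adj P.
  have uE : u *m diag_mx (\row_k (lam k)%:C%C) = x%:C%C *: u.
    have := congr1 (mulmx^~ (adj P)) vE.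
    by rewrite /specmx /= -scalemxAl !mulmxA -(mulmxA _ P) P1 mulmx1.
  have [k uk|u0] := pickP (fun k => u ord0 k != 0).
    exists k; have /rowP/(_ k) := uE.
    rewrite mul_mx_diag [LHS]mxE [RHS]mxE [(\row__ _) _ _]mxE mulrC.
    by move=> /(mulIf uk) [->].
  case/eqP: v0; rewrite -[v]mulmx1 -P2 mulmxA -/u.
  have -> : u = 0 by apply/rowP => k; rewrite [RHS]mxE; apply/eqP; have /negbFE := u0 k.
  by rewrite mul0mx.
move=> [k ->]; apply/eigenvalueP; exists (delta_mx ord0 k *m P).
  rewrite /specmx !mulmxA -(mulmxA _ P) P1 mulmx1 scalemxAl; congr (_ *m P).
  apply/rowP => j; rewrite mul_mx_diag !mxE eqxx/=.
  by case: eqP => [->|_]; rewrite ?mulr0 ?mul0r // mulrC.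
apply/negP => /eqP /(congr1 (mulmx^~ (adj P))) /=.
rewrite -mulmxA P1 mulmx1 mul0mx => /rowP/(_ k); rewrite !mxE !eqxx => /eqP.
by rewrite oner_eq0.
Qed.

Section Bounds.
Variables (H P : 'M[R[i]]_d) (lam : 'I_d -> R).
Hypotheses (uP : unitary P) (HE : H = specmx P (fun k => (lam k)%:C%C)) (d0 : (0 < d)%N).

Let eigE x : eigenvalue H x%:C%C <-> exists k, x = lam k.
Proof. by rewrite HE; exact: eigenvalue_specmx. Qed.

Lemma lambda_bounds k : lambda_min H <= lam k <= lambda_max H.
Proof.
have lek j : `|lam j| <= \sum_i `|lam i|.
  by rewrite (bigD1 j)//= lerDl sumr_ge0.
apply/andP; split.
  apply: ge_inf; last by apply/eigE; exists k.
  exists (- \sum_i `|lam i|) => x /eigE[j ->].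
  by have := lek j; rewrite ler_norml => /andP[].
apply: ub_le_sup; last by apply/eigE; exists k.
exists (\sum_i `|lam i|) => x /eigE[j ->].
by have := lek j; rewrite ler_norml => /andP[].
Qed.

Lemma opnorm_eigen_le k : `|lam k| <= opnorm H.
Proof.
have [P1 P2] := uP.
pose e : 'cV[R[i]]_d := adj P *m delta_mx k ord0.
have e1 : vnorm e = 1.
  rewrite /e vnorm_unitary; last exact: unitary_adj.
  apply/eqP; rewrite -(@eqrXn2 _ 2)// ?vnorm_ge0// vnorm_sqr expr1n (bigD1 k)//=.
  rewrite mxE !eqxx ComplexField.Normc.normc1 expr1n big1 ?addr0// => j /negbTE jk.
  by rewrite mxE jk ComplexField.Normc.normc0 expr0n.
have He : H *m e = (lam k)%:C%C *: e.
  rewrite HE /specmx /e !mulmxA -(mulmxA _ P) P1 mulmx1 -mulmxA scalemxAr; congr (_ *m _).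
  apply/colP => j; rewrite mul_diag_mx !mxE.
  by case: eqP => [->|_]; rewrite ?mulr0.
have := vnorm_le_opnorm H e.
by rewrite He vnormZ normc_realc e1 !mulr1.
Qed.

Lemma lambda_gap_ge0 : 0 <= lambda_max H - lambda_min H.
Proof.
by rewrite subr_ge0; have /andP[] := lambda_bounds (Ordinal d0); exact: le_trans.
Qed.

Lemma lambda_gap_le : lambda_max H - lambda_min H <= 2 * opnorm H.
Proof.
have k0 := Ordinal d0.
have hM : lambda_max H <= opnorm H.
  apply: ge_sup; first by exists (lam k0); apply/eigE; exists k0.
  by move=> x /eigE[k ->]; exact: le_trans (ler_norm _) (opnorm_eigen_le k).
have hm : - opnorm H <= lambda_min H.
  apply: lb_le_inf; first by exists (lam k0); apply/eigE; exists k0.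
  by move=> x /eigE[k ->]; have := opnorm_eigen_le k; rewrite ler_norml => /andP[].
lra.
Qed.

(* Shifting H by the midpoint of its spectrum does not change the commutator and makes
   its norm half the spectral gap. *)
Lemma opnorm_commutator_le X :
  opnorm (H *m X - X *m H) <= (lambda_max H - lambda_min H) * opnorm X.
Proof.
set w := lambda_max H - lambda_min H; pose c := (lambda_max H + lambda_min H) / 2.
pose K := H - (c%:C%C)%:M.
have -> : H *m X - X *m H = K *m X - X *m K.
  by rewrite /K mulmxBl mulmxBr scalar_mxC opprB addrA subrK.
have KE : K = specmx P (fun k => (lam k - c)%:C%C).
  rewrite /K HE -[X in _ - X]mulmx1 -(specmx1 uP) mul_scalar_mx !specmx_sum scaler_sumr.
  rewrite -sumrB; apply: eq_bigr => k _; rewrite scalerA mulr1 -scalerBl.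
  by rewrite -rmorphB.
have w0 := lambda_gap_ge0.
have hK : opnorm K <= w / 2.
  apply: opnorm_le => [v|]; last by rewrite divr_ge0.
  rewrite KE /specmx -!mulmxA vnorm_unitary; last exact: unitary_adj.
  apply: le_trans (@vnorm_diag_le _ _ _ (w / 2) _ _) _; last by rewrite vnorm_unitary.
  move=> k; rewrite mxE normc_realc ler_norml; have /andP[h1 h2] := lambda_bounds k.
  by rewrite /w /c; apply/andP; split; lra.
apply: le_trans (opnormB _ _) _.
have h1 := le_trans (opnormM K X) (ler_wpM2r (opnorm_ge0 X) hK).
have h2 := le_trans (opnormM X K) (ler_wpM2l (opnorm_ge0 X) hK).
by apply: le_trans (lerD h1 h2) _; rewrite le_eqVlt; apply/orP; left; apply/eqP; field.
Qed.

End Bounds.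
End Spectrum.

Lemma cvg_bigsum (K : numFieldType) (W : normedModType K) (I : Type) (s : seq I)
    (f : I -> nat -> W) (l : I -> W) :
  (forall i, f i @ \oo --> l i) ->
  (fun N => \sum_(i <- s) f i N) @ \oo --> \sum_(i <- s) l i.
Proof.
move=> fl; elim: s => [|i s IH].
  by under eq_fun do rewrite big_nil; rewrite big_nil; exact: cvg_cst.
by under eq_fun do rewrite big_cons; rewrite big_cons; apply: cvgD.
Qed.

Section Exponential.
Variable R : realType.

(** This is exp(-i x), with the sign of the exponent of the gates. *)
Definition cis (x : R) : R[i] := (cos x +i* (- sin x))%C.

Lemma exp_term (x : R) (j : nat) : (j`!%:R)^-1 * (- ('i%C * x%:C%C)) ^+ j =
  (cos_coeff x j +i* (- sin_coeff x j))%C :> R[i].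
Proof.
have fE : ((j`!%:R)^-1 : R[i]) = ((j`!%:R)^-1)%:C%C.
  by rewrite fmorphV rmorph_nat.
have pE : (- ('i%C * x%:C%C)) ^+ j =
    ((~~ odd j)%:R * (-1) ^+ j./2 * x ^+ j +i* (- ((odd j)%:R * (-1) ^+ j.-1./2 * x ^+ j)))%C :> R[i].
  elim: j {fE} => [|j IH]; first by rewrite expr0; apply/eqP; rewrite eq_complex /=; apply/andP; split; apply/eqP; ring.
  rewrite exprS IH /=; case: (boolP (odd j)) => oj /=.
    have -> : uphalf j = (j.-1./2).+1 by case: j oj {IH} => //= j; rewrite uphalfE.
    by rewrite !exprS; congr (_ +i* _)%C; rewrite /=; ring.
  by rewrite !exprS; congr (_ +i* _)%C; rewrite /=; ring.
rewrite pE fE /cos_coeff /sin_coeff /=; congr (_ +i* _)%C.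
  by rewrite mul0r subr0 mulrC.
by rewrite mul0r addr0; ring.
Qed.

(** A positive element of [R[i]] is real, so the tolerance [e] can be compared with real errors;
    errors below e/2 in both parts give a modulus below e. *)
Lemma cvg_complex (u : nat -> R[i]) (a b : nat -> R) (A B : R) :
  (forall N, u N = (a N +i* b N)%C) -> a @ \oo --> A -> b @ \oo --> B ->
  (u : nat -> (R[i] : numFieldType)) @ \oo --> ((A +i* B)%C : (R[i] : numFieldType)).
Proof.
move=> uE aA bB; apply/cvgrPdist_lt => e e0.
have : 0 < e := e0.
rewrite ltcE /= => /andP[/eqP Ime Ree].
have e2 : 0 < complex.Re e / 2 by rewrite divr_gt0.
have /cvgrPdist_lt/(_ _ e2) hA := aA; have /cvgrPdist_lt/(_ _ e2) hB := bB.
near=> N.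
have h1 : `|A - a N| < complex.Re e / 2 by near: N.
have h2 : `|B - b N| < complex.Re e / 2 by near: N.
rewrite uE; change (`|(A +i* B)%C - (a N +i* b N)%C| < e).
rewrite normc_def ltcE /= Ime eqxx /=.
have -> : complex.Re e = `|complex.Re e| by rewrite gtr0_norm.
rewrite -sqrtr_sqr ltr_sqrt; last by rewrite exprn_gt0.
move: h1 h2; rewrite !ltr_norml => /andP[? ?] /andP[? ?]; nra.
Unshelve. all: by end_near. Qed.

Lemma cvg_exp_series (x : R) :
  ((fun N => \sum_(j < N) (j`!%:R)^-1 * (- ('i%C * x%:C%C)) ^+ j) : nat -> (R[i] : numFieldType))
   @ \oo --> (cis x : (R[i] : numFieldType)).
Proof.
apply: (@cvg_complex _ (series (cos_coeff x)) (fun N => - series (sin_coeff x) N)).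
- move=> N; under eq_bigr do rewrite exp_term.
  by apply/eqP; rewrite eq_complex Re_sum Im_sum /series /= !big_mkord -sumrN !eqxx.
- by have := @is_cvg_series_cos_coeff _ x; rewrite cos.unlock.
- apply: cvgN; by have := @is_cvg_series_sin_coeff _ x; rewrite sin.unlock.
Qed.

(** Powers act on eigenvalues, so the matrix series is a finite combination of fixed spectral
    projectors whose coefficients are scalar exponential series. *)
Lemma expmx_specmx d (P : 'M[R[i]]_d) (lam : 'I_d -> R) (t : R) : unitary P ->
  expmx ((- ('i%C * t%:C%C)) *: specmx P (fun k => (lam k)%:C%C)) =
  specmx P (fun k => cis (t * lam k)).
Proof.
move=> uP; rewrite /expmx.
have powE j : ((- ('i%C * t%:C%C)) *: specmx P (fun k => (lam k)%:C%C)) ^+ j =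
    specmx P (fun k => (- ('i%C * (t * lam k)%:C%C)) ^+ j).
  elim: j => [|j IH]; first by rewrite expr0; exact/esym/specmx1.
  rewrite exprS IH -[LHS]/(_ *m _) -scalemxAl specmxM// !specmx_sum scaler_sumr.
  apply: eq_bigr => k _; rewrite scalerA exprS; congr (_ *: _).
  by rewrite rmorphM /= !mulrA !mulNr.
have hM := @norm_hausdorff (R[i] : numFieldType) 'M[(R[i] : numFieldType)]_d.
apply: (cvg_lim hM).
rewrite [X in X @ _ --> _](_ : _ = (fun N : nat =>
    \sum_k (\sum_(j < N) (j`!%:R)^-1 * (- ('i%C * (t * lam k)%:C%C)) ^+ j)
       *: (adj P *m delta_mx k k *m P) : 'M[(R[i] : numFieldType)]_d)); last first.
  apply/funext => N.
  under eq_bigr do rewrite powE specmx_sum scaler_sumr.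
  rewrite exchange_big /=; apply: eq_bigr => k _.
  by rewrite scaler_suml; apply: eq_bigr => j _; rewrite scalerA.
rewrite specmx_sum; apply: cvg_bigsum => k.
exact: cvgZr_tmp (@cvg_exp_series _).
Qed.

End Exponential.

(** * Derivatives of the evolved observable *)

Section MatrixDerivative.
Variable R : realType.

(** Same entrywise real and imaginary parts as in [dmx], but [is_derive] also asserts that the
    derivatives exist, which a value of [derive1] does not. *)
Definition mderiv p q (F : R -> 'M[R[i]]_(p, q)) (t : R) (F' : 'M[R[i]]_(p, q)) : Prop :=
  forall a b, is_derive t 1 (fun s => complex.Re (F s a b)) (complex.Re (F' a b)) /\
              is_derive t 1 (fun s => complex.Im (F s a b)) (complex.Im (F' a b)).

Lemma is_derive_bigsum (I : Type) (s : seq I) (f : I -> R -> R) (df : I -> R) (t : R) :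
  (forall i, is_derive t 1 (f i) (df i)) ->
  is_derive t 1 (fun x => \sum_(i <- s) f i x) (\sum_(i <- s) df i).
Proof.
move=> h; elim: s => [|i s IH].
  by under eq_fun do rewrite big_nil; rewrite big_nil; exact: is_derive_cst.
by under eq_fun do rewrite big_cons; rewrite big_cons; exact: is_deriveD_fun.
Qed.

Lemma mderiv_cst p q (A : 'M[R[i]]_(p, q)) t : mderiv (fun=> A) t 0.
Proof. by move=> a b; rewrite mxE; split; exact: is_derive_cst. Qed.

Lemma mderivD p q (F G : R -> 'M[R[i]]_(p, q)) t F' G' :
  mderiv F t F' -> mderiv G t G' -> mderiv (fun s => F s + G s) t (F' + G').
Proof.
move=> hF hG a b; rewrite mxE cReD cImD; have [h1 h2] := hF a b; have [h3 h4] := hG a b.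
split; under eq_fun do rewrite mxE ?cReD ?cImD.
  exact: is_deriveD_fun.
exact: is_deriveD_fun.
Qed.

Lemma mderivM p q s (F : R -> 'M[R[i]]_(p, q)) (G : R -> 'M[R[i]]_(q, s)) t F' G' :
  mderiv F t F' -> mderiv G t G' ->
  mderiv (fun x => F x *m G x) t (F' *m G t + F t *m G').
Proof.
move=> hF hG a b; split.
  under eq_fun do rewrite mxE Re_sum.
  apply: is_derive_eq.
    apply: (@is_derive_bigsum _ _ _ (fun k => complex.Re (F' a k * G t k b + F t a k * G' k b))) => k.
    under eq_fun do rewrite cReM.
    have [h1 h2] := hF a k; have [h3 h4] := hG k b.
    apply: (is_derive_eq (is_deriveD_fun (is_deriveM_fun h1 h3)
      (is_deriveN (is_deriveM_fun h2 h4)))).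
    by rewrite cReD !cReM; ring.
  by rewrite !mxE -big_split/= Re_sum.
under eq_fun do rewrite mxE Im_sum.
apply: is_derive_eq.
  apply: (@is_derive_bigsum _ _ _ (fun k => complex.Im (F' a k * G t k b + F t a k * G' k b))) => k.
  under eq_fun do rewrite cImM.
  have [h1 h2] := hF a k; have [h3 h4] := hG k b.
  apply: (is_derive_eq (is_deriveD_fun (is_deriveM_fun h1 h4) (is_deriveM_fun h2 h3))).
  by rewrite cImD !cImM; ring.
by rewrite !mxE -big_split/= Im_sum.
Qed.

Lemma mderiv_mull p q s (A : 'M[R[i]]_(p, q)) (G : R -> 'M[R[i]]_(q, s)) t G' :
  mderiv G t G' -> mderiv (fun x => A *m G x) t (A *m G').
Proof. by move=> /(mderivM (mderiv_cst A t)); rewrite mul0mx add0r. Qed.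

Lemma mderiv_mulr p q s (A : 'M[R[i]]_(q, s)) (F : R -> 'M[R[i]]_(p, q)) t F' :
  mderiv F t F' -> mderiv (fun x => F x *m A) t (F' *m A).
Proof. by move=> hF; have := mderivM hF (mderiv_cst A t); rewrite mulmx0 addr0. Qed.

Lemma mderivZ p q (c : R[i]) (F : R -> 'M[R[i]]_(p, q)) t F' :
  mderiv F t F' -> mderiv (fun x => c *: F x) t (c *: F').
Proof.
move=> /(@mderiv_mull _ _ _ (c%:M)); rewrite mul_scalar_mx.
by under eq_fun do rewrite mul_scalar_mx.
Qed.

Lemma mderivB p q (F G : R -> 'M[R[i]]_(p, q)) t F' G' :
  mderiv F t F' -> mderiv G t G' -> mderiv (fun s => F s - G s) t (F' - G').
Proof.
move=> hF /(mderivZ (-1)) hG; have := mderivD hF hG; rewrite scaleN1r.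
by under eq_fun do rewrite scaleN1r.
Qed.

Lemma mderiv_adj p q (F : R -> 'M[R[i]]_(p, q)) t F' :
  mderiv F t F' -> mderiv (fun x => adj (F x)) t (adj F').
Proof.
move=> hF a b; have [h1 h2] := hF b a.
have E (A : 'M[R[i]]_(p, q)) : complex.Re (adj A a b) = complex.Re (A b a) /\
    complex.Im (adj A a b) = - complex.Im (A b a).
  by rewrite !mxE; case: (A b a).
split.
  by under eq_fun do rewrite (E _).1; rewrite (E _).1.
by under eq_fun do rewrite (E _).2; rewrite (E _).2; exact: is_deriveN.
Qed.

Lemma dmx_mderiv d (F : R -> 'M[R[i]]_d) t F' : mderiv F t F' -> dmx F t = F'.
Proof.
move=> hF; apply/matrixP => a b; rewrite mxE !derive1E.
have [h1 h2] := hF a b; rewrite (@derive_val _ _ _ _ _ _ _ h1) (@derive_val _ _ _ _ _ _ _ h2).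
by case: (F' a b).
Qed.

Lemma mderiv_continuous p q (F F' : R -> 'M[R[i]]_(p, q)) a b :
  (forall t, mderiv F t (F' t)) ->
  continuous (fun s => complex.Re (F s a b)) /\ continuous (fun s => complex.Im (F s a b)).
Proof.
move=> hF; split.
  exact: is_derive_continuous (fun t => (hF t a b).1).
exact: is_derive_continuous (fun t => (hF t a b).2).
Qed.

End MatrixDerivative.

Section Propagator.
Variables (R : realType) (d : nat) (H : 'M[R[i]]_d) (hH : is_hermitian H).

Definition propag (t : R) : 'M[R[i]]_d := expmx ((- ('i%C * t%:C%C)) *: H).

Let propagE : exists (P : 'M[R[i]]_d) (lam : 'I_d -> R), [/\ unitary P,
  H = specmx P (fun k => (lam k)%:C%C) &
  forall t, propag t = specmx P (fun k => cis (t * lam k))].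
Proof.
have [P [lam [uP HE]]] := hermitian_spectral hH.
exists P, lam; split => // t; rewrite /propag HE.
exact: expmx_specmx.
Qed.

Lemma propag_unitary t : unitary (propag t).
Proof.
have [P [lam [uP _ ->]]] := propagE; apply: specmx_unitary => // k.
apply/eqP; rewrite eq_complex /cis /=; apply/andP; split; apply/eqP; last by ring.
by rewrite -(cos2Dsin2 (t * lam k)); ring.
Qed.

Lemma propag_comm t : H *m propag t = propag t *m H.
Proof.
have [P [lam [uP HE ->]]] := propagE; rewrite HE !specmxM//.
by congr specmx; apply/funext => k; rewrite mulrC.
Qed.

Lemma propag_adj_comm t : H *m adj (propag t) = adj (propag t) *m H.
Proof. by rewrite -{1}hH -{2}hH -!adjM propag_comm. Qed.

Lemma propag_mderiv t : mderiv propag t ((- 'i%C) *: (H *m propag t)).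
Proof.
have [P [lam [uP HE pE]]] := propagE.
rewrite pE HE specmxM//; have -> : propag = fun s => specmx P (fun k => cis (s * lam k)).
  by apply/funext.
have dl (l : R) : is_derive t 1 (fun s : R => s * l) l.
  apply: (is_derive_eq (is_deriveM_fun (is_derive_id t 1) (is_derive_cst l t 1))).
  by rewrite mulr0 addr0 mul1r.
have dc (l : R) : is_derive t 1 (fun s => cos (s * l)) (- sin (t * l) * l).
  have := @is_derive1_comp _ cos (fun s => s * l) t _ _ (is_derive_cos (t * l)) (dl l).
  by [].
have ds (l : R) : is_derive t 1 (fun s => sin (s * l)) (cos (t * l) * l).
  have := @is_derive1_comp _ sin (fun s => s * l) t _ _ (is_derive_sin (t * l)) (dl l).
  by [].
rewrite scalemxAl scalemxAr; apply: mderiv_mulr; apply: mderiv_mull.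
move=> a b.
have [ab|ab] := eqVneq a b; last first.
  rewrite !mxE (negbTE ab) mulr0n mulr0 /=.
  by split; under eq_fun do rewrite !mxE (negbTE ab) mulr0n /=; exact: is_derive_cst.
rewrite !mxE ab eqxx !mulr1n /=; split; under eq_fun do rewrite !mxE ?ab eqxx mulr1n /=.
  by apply: (is_derive_eq (dc (lam b))); ring.
by apply: (is_derive_eq (is_deriveN (ds (lam b)))); ring.
Qed.

(** The generator of t |-> e^{itH} X e^{-itH}, see [mderiv_conj]. It commutes with this conjugation
    because H commutes with its own exponential, so repeated derivatives are iterates of [ad]. *)
Definition ad (X : 'M[R[i]]_d) : 'M[R[i]]_d := 'i%C *: (H *m X - X *m H).

Lemma ad_conj X t : ad (adj (propag t) *m X *m propag t) =
  adj (propag t) *m ad X *m propag t.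
Proof.
rewrite /ad -scalemxAr -scalemxAl mulmxBr mulmxBl !mulmxA propag_adj_comm.
by congr (_ *: (_ - _)); rewrite -!mulmxA propag_comm.
Qed.

Lemma iter_ad_conj n X t : iter n ad (adj (propag t) *m X *m propag t) =
  adj (propag t) *m iter n ad X *m propag t.
Proof. by elim: n => //= n ->; rewrite ad_conj. Qed.

Lemma mderiv_ad F t F' : mderiv F t F' -> mderiv (fun s => ad (F s)) t (ad F').
Proof.
move=> hF; apply: mderivZ; apply: mderivB; first exact: mderiv_mull.
exact: mderiv_mulr.
Qed.

Lemma mderiv_iter_ad n F t F' :
  mderiv F t F' -> mderiv (fun s => iter n ad (F s)) t (iter n ad F').
Proof. by move=> hF; elim: n => //= n IH; exact: mderiv_ad. Qed.

Lemma mderiv_conj X t : mderiv (fun s => adj (propag s) *m X *m propag s) t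
  (ad (adj (propag t) *m X *m propag t)).
Proof.
have h := propag_mderiv t.
have := mderivM (mderiv_mulr X (mderiv_adj h)) h; congr mderiv.
have aZ (c : R[i]) (A : 'M[R[i]]_d) : adj (c *: A) = conjc c *: adj A.
  by apply/matrixP => i j; rewrite !mxE rmorphM.
have -> : adj ((- 'i%C) *: (H *m propag t)) = 'i%C *: (H *m adj (propag t)).
  rewrite aZ adjM hH propag_adj_comm; congr (_ *: _).
  by apply/eqP; rewrite eq_complex /= !oppr0 opprK !eqxx.
rewrite /ad scalerBr -!scalemxAl -scalemxAr scaleNr propag_comm !mulmxA.
by [].
Qed.

Lemma opnorm_ad_le X : (0 < d)%N ->
  opnorm (ad X) <= (lambda_max H - lambda_min H) * opnorm X.
Proof.
move=> d0; have [P [lam [uP HE _]]] := propagE.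
apply: le_trans (opnorm_commutator_le uP HE d0 X).
by apply: opnormZ_unit; rewrite /= expr0n expr1n add0r sqrtr1.
Qed.

Lemma gap_ge0 : (0 < d)%N -> 0 <= lambda_max H - lambda_min H.
Proof. by move=> d0; have [P [lam [uP HE _]]] := propagE; exact: lambda_gap_ge0 HE d0. Qed.

Lemma gap_le : (0 < d)%N -> lambda_max H - lambda_min H <= 2 * opnorm H.
Proof. by move=> d0; have [P [lam [uP HE _]]] := propagE; exact: lambda_gap_le HE d0. Qed.

End Propagator.

Lemma enum_ord_pairwise m : pairwise (fun i k : 'I_m => (i < k)%N) (enum 'I_m).
Proof.
rewrite -(pairwise_map val ltn) val_enum_ord -sorted_pairwise; last exact: ltn_trans.
exact: iota_ltn_sorted.
Qed.

Section SeparableMatrix.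
Variables (R : realType) (m : nat).

Definition msep p q (F : ('I_m -> R) -> 'M[R[i]]_(p, q)) : Prop :=
  forall a b, sep (fun th => complex.Re (F th a b)) /\ sep (fun th => complex.Im (F th a b)).

Lemma msep_cst p q (A : 'M[R[i]]_(p, q)) : msep (fun=> A).
Proof. by move=> a b; split; exact: sep_cst. Qed.

Lemma msepM p q s (F : ('I_m -> R) -> 'M[R[i]]_(p, q)) (G : ('I_m -> R) -> 'M[R[i]]_(q, s)) :
  msep F -> msep G -> msep (fun th => F th *m G th).
Proof.
move=> hF hG a b; split.
  under eq_fun do rewrite mxE Re_sum.
  apply: sep_sum => k; under eq_fun do rewrite cReM.
  have [h1 h2] := hF a k; have [h3 h4] := hG k b.
  by apply: sepB; apply: sepM.
under eq_fun do rewrite mxE Im_sum.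
apply: sep_sum => k; under eq_fun do rewrite cImM.
have [h1 h2] := hF a k; have [h3 h4] := hG k b.
by apply: sepD; apply: sepM.
Qed.

Lemma msepD p q (F G : ('I_m -> R) -> 'M[R[i]]_(p, q)) :
  msep F -> msep G -> msep (fun th => F th + G th).
Proof.
move=> hF hG a b; have [h1 h2] := hF a b; have [h3 h4] := hG a b.
split.
  by under eq_fun do rewrite mxE cReD; exact: sepD.
by under eq_fun do rewrite mxE cImD; exact: sepD.
Qed.

Lemma msepZ p q (c : R[i]) (F : ('I_m -> R) -> 'M[R[i]]_(p, q)) :
  msep F -> msep (fun th => c *: F th).
Proof.
move=> /(msepM (msep_cst c%:M)).
by under [in X in X -> _]eq_fun do rewrite mul_scalar_mx.
Qed.

Lemma msep_coord p q (F : R -> 'M[R[i]]_(p, q)) (k : 'I_m) :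
  (forall a b, continuous (fun s => complex.Re (F s a b)) /\
               continuous (fun s => complex.Im (F s a b))) ->
  msep (fun th => F (th k)).
Proof.
move=> hF a b; have [h1 h2] := hF a b; split.
  exact: (sep_coord k h1).
exact: (sep_coord k h2).
Qed.

Lemma sep_Re_trace d (A : 'M[R[i]]_d) (F : ('I_m -> R) -> 'M[R[i]]_d) :
  msep F -> sep (fun th => complex.Re (\tr (A *m F th))).
Proof.
move=> /(msepM (msep_cst A)) h; rewrite /mxtrace.
by under eq_fun do rewrite Re_sum; apply: sep_sum => k; exact: (h k k).1.
Qed.

Lemma is_derive_Re_trace d (A : 'M[R[i]]_d) (F : R -> 'M[R[i]]_d) t F' :
  mderiv F t F' ->
  is_derive t 1 (fun s => complex.Re (\tr (A *m F s))) (complex.Re (\tr (A *m F'))).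
Proof.
move=> /(mderiv_mull A) h; rewrite /mxtrace Re_sum; under eq_fun do rewrite Re_sum.
by apply: is_derive_bigsum => k; exact: (h k k).1.
Qed.

End SeparableMatrix.

(* Keeps conversion from unfolding suprema and series when it compares two norms. *)
#[local] Opaque opnorm expmx.

(** * The evolved observable as a fold over the gates *)

Section Tower.
Variables (R : realType) (d m : nat) (O : 'M[R[i]]_d) (V H : 'I_m -> 'M[R[i]]_d).
Hypotheses (uV : forall l, unitary (V l)) (hH : forall l, is_hermitian (H l)).
Implicit Types (j : 'I_m -> nat) (th : 'I_m -> R) (s : seq 'I_m).

(* The Heisenberg-evolved observable, differentiated [j k] times in the coordinate [k]:
   each derivative inserts one commutator with [H k] after the k-th conjugation. *)
Definition gstep j th (X : 'M[R[i]]_d) (k : 'I_m) : 'M[R[i]]_d :=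
  iter (j k) (ad (H k))
    (adj (propag (H k) (th k)) *m (adj (V k) *m X *m V k) *m propag (H k) (th k)).

Definition dheis j th : 'M[R[i]]_d := foldl (gstep j th) O (enum 'I_m).

Definition jinc (l : 'I_m) j : 'I_m -> nat := fun k => if k == l then (j k).+1 else j k.

(** The first gate is the innermost conjugation of [O] in U^+ O U, hence a left fold in increasing
    order of the index. *)
Lemma heis_dheis : heis O V H = dheis (fun=> 0%N).
Proof.
apply/funext => th; rewrite /heis /dheis.
pose g (l : 'I_m) := V l *m propag (H l) (th l).
have -> : circuit V H th = \prod_(l <- enum 'I_m) g l by rewrite enumT.
elim: (enum 'I_m) O => [|k s IH] X /=.
  by rewrite big_nil -[1]/(1%:M) adj_1mx mul1mx mulmx1.
rewrite big_cons -[g k * _]/(_ *m _) adjM -IH.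
by rewrite /gstep /= /g adjM !mulmxA.
Qed.

Lemma eq_foldl_gstep j j' th th' s X :
  {in s, forall k, j k = j' k /\ th k = th' k} ->
  foldl (gstep j th) X s = foldl (gstep j' th') X s.
Proof.
elim: s X => //= k s IH X h.
have [jk tk] := h k (mem_head _ _).
have -> : gstep j' th' X k = gstep j th X k by rewrite /gstep jk tk.
apply: IH => i si.
by apply: h; rewrite inE si orbT.
Qed.

Lemma enum_ord_split (l : 'I_m) : exists s1 s2, [/\ enum 'I_m = s1 ++ l :: s2,
  {in s1, forall k : 'I_m, (k < l)%N} & {in s2, forall k : 'I_m, (l < k)%N}].
Proof.
have := enum_ord_pairwise m.
have : l \in enum 'I_m by rewrite mem_enum.
move=> /path.splitPr; case => s1 s2.
rewrite pairwise_cat /= => /and3P[h1 _ /andP[h2 _]].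
exists s1, s2; split => // k ks.
  by have /allrelP/(_ k l ks (mem_head _ _)) := h1.
exact: (allP h2).
Qed.

Lemma mderiv_foldl j th s F t F' : mderiv F t F' ->
  mderiv (fun x => foldl (gstep j th) (F x) s) t (foldl (gstep j th) F' s).
Proof.
elim: s F F' => //= k s IH F F' hF; apply: (IH (fun x => gstep j th (F x) k)).
apply: mderiv_iter_ad; apply: mderiv_mulr; apply: mderiv_mull; apply: mderiv_mulr.
exact: mderiv_mull.
Qed.

(** The fold is cut at [l]: the gates before [l] give a constant matrix, gate [l] gains one
    commutator, and the gates after [l] act as a fixed linear map, through which the derivative
    passes. *)
Lemma mderiv_dheis j th l t :
  mderiv (fun x => dheis j (upd th l x)) t (dheis (jinc l j) (upd th l t)).
Proof.
have [s1 [s2 [E h1 h2]]] := enum_ord_split l.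
have n1 k : k \in s1 -> k != l by move=> /h1; rewrite ltn_neqAle => /andP[].
have n2 k : k \in s2 -> k != l by move=> /h2; rewrite ltn_neqAle eq_sym => /andP[].
have EE i x : (forall k, k != l -> i k = j k) -> dheis i (upd th l x) =
    foldl (gstep j th) (gstep i (upd th l x) (foldl (gstep j th) O s1) l) s2.
  move=> ij; rewrite /dheis E foldl_cat.
  have a1 : foldl (gstep i (upd th l x)) O s1 = foldl (gstep j th) O s1.
    by apply: eq_foldl_gstep => k /n1 kl; rewrite upd_diff// ij.
  have a2 X : foldl (gstep i (upd th l x)) X s2 = foldl (gstep j th) X s2.
    by apply: eq_foldl_gstep => k /n2 kl; rewrite upd_diff// ij.
  exact: (etrans (a2 _) (congr1 (fun X => foldl (gstep j th) (gstep i (upd th l x) X l) s2) a1)).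
have -> : (fun x => dheis j (upd th l x)) =
    (fun x => foldl (gstep j th) (gstep j (upd th l x) (foldl (gstep j th) O s1) l) s2).
  by apply/funext => x; exact: EE.
rewrite EE; last by move=> k /negbTE kl; rewrite /jinc kl.
apply: (@mderiv_foldl j th s2 (fun x => gstep j (upd th l x) (foldl (gstep j th) O s1) l)).
set X := foldl _ _ _.
have -> : (fun x => gstep j (upd th l x) X l) = (fun x => iter (j l) (ad (H l))
    (adj (propag (H l) x) *m (adj (V l) *m X *m V l) *m propag (H l) x)).
  by apply/funext => x; rewrite /gstep upd_same.
rewrite /gstep /jinc eqxx upd_same.
(* The new commutator is read as the innermost one, where it is the derivative of the bare
   conjugation. *)
rewrite iterSr; apply: mderiv_iter_ad; exact: mderiv_conj.
Qed.

Lemma pdmx_dheis j l : pdmx l (dheis j) = dheis (jinc l j).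
Proof.
apply/funext => th; rewrite /pdmx (dmx_mderiv (mderiv_dheis j th l (th l))).
by rewrite upd_id.
Qed.

Lemma msep_dheis j : msep (dheis j).
Proof.
suff fold_msep s (F : ('I_m -> R) -> 'M[R[i]]_d) : msep F ->
    msep (fun th => foldl (gstep j th) (F th) s).
  by apply: (fold_msep _ (fun=> O)); exact: msep_cst.
elim: s F => //= k s IH F hF.
apply: (IH (fun th => gstep j th (F th) k)).
have hP : msep (fun th => propag (H k) (th k)).
  by apply: msep_coord => a b; exact: mderiv_continuous (propag_mderiv (hH k)).
have hP' : msep (fun th => adj (propag (H k) (th k))).
  apply: (msep_coord (F := fun x => adj (propag (H k) x))) => a b.
  exact: mderiv_continuous (fun t => mderiv_adj (propag_mderiv (hH k) t)).
rewrite /gstep; elim: (j k) => [|n IHn] /=.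
  apply: msepM => //; apply: msepM => //; apply: msepM; last exact: msep_cst.
  by apply: msepM => //; exact: msep_cst.
apply: msepZ; apply: msepD; first by apply: msepM => //; exact: msep_cst.
have := msepZ (-1) (msepM IHn (msep_cst m (H k))).
by under [in X in X -> _]eq_fun do rewrite scaleN1r.
Qed.

Lemma opnorm_gstep j th X k : opnorm (gstep j th X k) =
  opnorm (iter (j k) (ad (H k)) (adj (V k) *m X *m V k)).
Proof.
rewrite /gstep (iter_ad_conj (hH k)).
exact: (opnorm_conj _ (propag_unitary (hH k) (th k))).
Qed.

Lemma opnorm_foldl0 j th s X : {in s, forall k, j k = 0%N} ->
  opnorm (foldl (gstep j th) X s) = opnorm X.
Proof.
elim: s X => [|k s IH] X h; first by [].
have hs : {in s, forall k, j k = 0%N} by move=> i si; apply: h; rewrite inE si orbT.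
have hk : j k = 0%N by apply: h; exact: mem_head.
apply: (etrans (IH (gstep j th X k) hs)); rewrite opnorm_gstep hk.
exact: (opnorm_conj X (uV k)).
Qed.

Lemma opnorm_dheis0 th : opnorm (dheis (fun=> 0%N) th) = opnorm O.
Proof. exact: opnorm_foldl0. Qed.

Lemma opnorm_dheis_split j th (l : 'I_m) s1 s2 : enum 'I_m = s1 ++ l :: s2 ->
  {in s2, forall k, j k = 0%N} ->
  opnorm (dheis j th) =
  opnorm (iter (j l) (ad (H l)) (adj (V l) *m foldl (gstep j th) O s1 *m V l)).
Proof.
move=> E j0; rewrite /dheis E foldl_cat.
exact: (etrans (opnorm_foldl0 th (gstep j th (foldl (gstep j th) O s1) l) j0)
  (opnorm_gstep j th (foldl (gstep j th) O s1) l)).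
Qed.

(** Later gates are unitary conjugations and preserve the norm. The conjugation by the exponential
    of gate [l] commutes with its own commutators and drops out too, so agreement strictly before
    [l] suffices. *)
Lemma opnorm_dheis_indep j th th' (l : 'I_m) :
  (forall k : 'I_m, (l < k)%N -> j k = 0%N) ->
  (forall k : 'I_m, (k < l)%N -> th k = th' k) ->
  opnorm (dheis j th) = opnorm (dheis j th').
Proof.
move=> j0 tt'; have [s1 [s2 [E h1 h2]]] := enum_ord_split l.
have j02 : {in s2, forall k, j k = 0%N} by move=> k /h2; exact: j0.
have e : foldl (gstep j th) O s1 = foldl (gstep j th') O s1.
  by apply: eq_foldl_gstep => k /h1 /tt'.
apply: (etrans (opnorm_dheis_split th E j02)).
apply: (etrans _ (esym (opnorm_dheis_split th' E j02))).
exact: (congr1 (fun X => opnorm (iter (j l) (ad (H l)) (adj (V l) *m X *m V l))) e).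
Qed.

(** As no later coordinate is differentiated, the new commutator is the outermost operation up to
    unitary conjugations, and the spectral gap bounds it. *)
Lemma opnorm_dheis_jinc j th (l : 'I_m) : (0 < d)%N ->
  (forall k : 'I_m, (l < k)%N -> j k = 0%N) ->
  opnorm (dheis (jinc l j) th) <= omega_max H l * opnorm (dheis j th).
Proof.
move=> d0 j0; have [s1 [s2 [E h1 h2]]] := enum_ord_split l.
have j02 : {in s2, forall k, j k = 0%N} by move=> k /h2; exact: j0.
have j12 : {in s2, forall k, jinc l j k = 0%N}.
  by move=> k /h2 lk; rewrite /jinc ifF ?j0//; apply/negP => /eqP kl; rewrite kl ltnn in lk.
have e : foldl (gstep (jinc l j) th) O s1 = foldl (gstep j th) O s1.
  apply: eq_foldl_gstep => k /h1 kl; rewrite /jinc ifF//.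
  by apply/negP => /eqP kl'; rewrite kl' ltnn in kl.
have jl : jinc l j l = (j l).+1 by rewrite /jinc eqxx.
have e1 : opnorm (dheis (jinc l j) th) = opnorm (iter (j l).+1 (ad (H l))
    (adj (V l) *m foldl (gstep j th) O s1 *m V l)).
  apply: (etrans (opnorm_dheis_split th E j12)); rewrite jl.
  exact: (congr1 (fun X => opnorm (iter (j l).+1 (ad (H l)) (adj (V l) *m X *m V l))) e).
rewrite [X in X <= _]e1 [X in _ <= _ * X](opnorm_dheis_split th E j02).
exact: (opnorm_ad_le (hH l)).
Qed.

End Tower.

(** * Lower bounds on the variance *)

#[local] Opaque dheis.

Section Bessel.
Variables (R : realType) (m : nat) (phi : 'I_m -> R) (r : R).
Hypothesis r0 : 0 < r.
Implicit Types f g : ('I_m -> R) -> R.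

Let lam (k : 'I_m) := umean (phi k) r.
Let hlam k : is_mean (lam k). Proof. exact: umean_is_mean. Qed.
Let E f := lavg lam (enum 'I_m) f phi.

Definition qleg (l : 'I_m) (th : 'I_m -> R) : R := leg2 (phi l) r (th l).

Lemma sep_qleg l : sep (qleg l).
Proof. exact: (sep_coord l (@continuous_leg2 _ (phi l) r)). Qed.

Lemma unif_mean_lavg f : unif_mean phi r f = E f.
Proof. exact: iavg_lavg. Qed.

Lemma lavg_full f l : sep f ->
  E f = lavg lam (rem l (enum 'I_m)) (fun t => lam l (fun x => f (upd t l x))) phi.
Proof. by move=> sf; apply: lavg_rem => //; rewrite ?enum_uniq ?mem_enum. Qed.

Let E_qleg l : E (qleg l) = 0.
Proof.
rewrite (lavg_full l); last exact: sep_qleg.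
rewrite (_ : (fun t => _) = fun=> 0) ?lavg_cst//; apply/funext => t.
rewrite /qleg; under eq_fun do rewrite upd_same.
exact: umean_leg2.
Qed.

Let E_qleg2 l k : E (fun t => qleg l t * qleg k t) = if l == k then 4 * r ^+ 4 / 45 else 0.
Proof.
rewrite (lavg_full l); last by apply: sepM; exact: sep_qleg.
have [<-|lk] := eqVneq l k.
  rewrite (_ : (fun t => _) = fun=> 4 * r ^+ 4 / 45) ?lavg_cst//; apply/funext => t.
  rewrite /qleg; under eq_fun do rewrite upd_same.
  exact: umean_leg2_sqr.
rewrite (_ : (fun t => _) = fun=> 0) ?lavg_cst//; apply/funext => t.
rewrite /qleg; under eq_fun do rewrite upd_same upd_diff 1?eq_sym// mulrC.
rewrite (meanZ (hlam l)); last exact: continuous_leg2.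
by rewrite /lam umean_leg2// mulr0.
Qed.

Lemma bessel_variance f (Lam : {set 'I_m}) : sep f ->
  \sum_(l in Lam) E (fun t => f t * qleg l t) ^+ 2 / (4 * r ^+ 4 / 45)
    <= unif_var phi r f.
Proof.
move=> sf; rewrite /unif_var !unif_mean_lavg; set N := 4 * r ^+ 4 / 45.
have N0 : 0 < N by rewrite divr_gt0// mulr_gt0// exprn_gt0.
pose e l := E (fun t => f t * qleg l t).
(* The orthogonal projection of [f] onto the span of the [qleg l]; each [e l / N] is a Fourier
   coefficient. *)
pose S t := \sum_(l in Lam) (e l / N) * qleg l t.
have sS : sep S by apply: sep_sum => l; apply: sepZ; exact: sep_qleg.
have sfq l : sep (fun t => f t * qleg l t) by apply: sepM => //; exact: sep_qleg.
have sfS : sep (fun t => f t * S t) by exact: sepM.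
have sff : sep (fun t => f t ^+ 2) by under eq_fun do rewrite expr2; exact: sepM.
have sSS : sep (fun t => S t * S t) by exact: sepM.
have ES : E S = 0.
  rewrite /E lavg_sum//; last by move=> l; apply: sepZ; exact: sep_qleg.
  rewrite big1// => l _; rewrite lavgZ//; last exact: sep_qleg.
  by rewrite -/(E _) E_qleg mulr0.
have EfS : E (fun t => f t * S t) = \sum_(l in Lam) e l ^+ 2 / N.
  rewrite /E /S; under eq_fun do rewrite mulr_sumr.
  rewrite lavg_sum//; last first.
    by move=> l; apply: sepM => //; apply: sepZ; exact: sep_qleg.
  apply: eq_bigr => l _; under eq_fun do rewrite mulrCA.
  by rewrite lavgZ// -/(E _) -/(e l) expr2 mulrAC.
have ESS : E (fun t => S t * S t) = \sum_(l in Lam) e l ^+ 2 / N.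
  have -> : (fun t => S t * S t) = (fun t => \sum_(l in Lam) \sum_(k in Lam)
      (e l / N * (e k / N)) * (qleg l t * qleg k t)).
    apply/funext => t; rewrite /S big_distrlr/=; apply: eq_bigr => l _.
    by apply: eq_bigr => k _; rewrite mulrACA.
  have sqq l k : sep (fun t => qleg l t * qleg k t) by apply: sepM; exact: sep_qleg.
  rewrite /E lavg_sum//; last first.
    by move=> l; apply: sep_sum => k; exact: sepZ.
  apply: eq_bigr => l lL; rewrite lavg_sum//; last by move=> k; exact: sepZ.
  rewrite (bigD1 l)//= lavgZ// -/(E _) E_qleg2 eqxx big1 ?addr0.
    by rewrite -/N; field; rewrite gt_eqF.
  move=> k /andP[_ kl]; rewrite lavgZ// -/(E _) E_qleg2 eq_sym (negbTE kl).
  by rewrite mulr0.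
(* The mean of the squared residual is nonnegative and equals the variance minus the sum of the
   [e l ^+ 2 / N]. The expansion below is nested to the right so that the linearity lemmas peel off
   one term at a time. *)
pose g t := (f t - E f) - S t.
have sg0 : sep (fun t => f t - E f) by apply: sepB => //; exact: sep_cst.
have sg : sep g by exact: sepB.
have : 0 <= E (fun t => g t * g t).
  rewrite -[X in X <= _](lavg_cst hlam (enum 'I_m) 0 phi); apply: lavg_le => //.
  - exact: sep_cst.
  - exact: sepM.
  - by move=> t _; rewrite -expr2 sqr_ge0.
have -> : (fun t => g t * g t) = (fun t => f t ^+ 2 + ((- 2 * E f) * f t +
    (E f ^+ 2 + ((- 2) * (f t * S t) + (2 * E f * S t + S t * S t))))).
  by apply/funext => t; rewrite /g; ring.
have s1 : sep (fun t => 2 * E f * S t + S t * S t) by apply: sepD => //; exact: sepZ.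
have s2 : sep (fun t => (- 2) * (f t * S t) + (2 * E f * S t + S t * S t)).
  by apply: sepD => //; exact: sepZ.
have s3 : sep (fun t => E f ^+ 2 + ((- 2) * (f t * S t) + (2 * E f * S t + S t * S t))).
  by apply: sepD => //; exact: sep_cst.
have s4 : sep (fun t => (- 2 * E f) * f t +
    (E f ^+ 2 + ((- 2) * (f t * S t) + (2 * E f * S t + S t * S t)))).
  by apply: sepD => //; exact: sepZ.
rewrite {1}/E lavgD// lavg_lin// lavgD//; last exact: sep_cst.
rewrite lavg_cst// lavg_lin// lavg_lin// -!/(E _) EfS ES ESS.
set T := \sum_(l in Lam) _; set Ef := E f; set Ef2 := E _; lra.
Qed.

End Bessel.

(** Collects the costs of all coordinates in the shape of [A_coef]: those before [l] feed the first
    sum, those after [l] the second. Nonnegativity of [w] and [u] allows the passage from w to 4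
    w. *)
Lemma sum_split_ord_le (R : realType) (m : nat) (l : 'I_m) (b s w : R) (u v : 'I_m -> R) :
  0 <= s -> 0 <= w -> (forall k, 0 <= u k) ->
  \sum_(k <- enum 'I_m) ((if k == l then b else 0) +
    ((if (k < l)%N then s / 6 * (w * u k) else 0) + (if (l < k)%N then s / 6 * v k else 0)))
  <= b + (4 * w * (\sum_(k < m | (k < l)%N) u k) + \sum_(k < m | (l < k)%N) v k) * s / 6.
Proof.
move=> s0 w0 u0; rewrite enumT 2!big_split/= -!big_mkcond/= big_pred1_eq lerD2l -!mulr_sumr.
set S1 := \sum_(k | _) _; set S2 := \sum_(k | _) _.
have S10 : 0 <= S1 by exact: sumr_ge0.
have := mulr_ge0 (mulr_ge0 w0 S10) s0.
have -> : s / 6 * (w * S1) + s / 6 * S2 = (w * S1 * s + S2 * s) / 6 by field.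
have -> : (4 * w * S1 + S2) * s / 6 = (4 * (w * S1 * s) + S2 * s) / 6 by field.
move: (w * S1 * s) (S2 * s) => x y x0; lra.
Qed.

(** * Weighted mean of the curvature against its value at the centre *)

Section Curvature.
Variables (R : realType) (d m : nat) (rho O : 'M[R[i]]_d) (V H : 'I_m -> 'M[R[i]]_d)
  (phi : 'I_m -> R).
Hypotheses (d0 : (0 < d)%N) (hrho : density_operator rho) (uV : forall l, unitary (V l))
  (hH : forall l, is_hermitian (H l)).
Implicit Types (j : 'I_m -> nat) (th : 'I_m -> R).

Definition dloss j th : R := complex.Re (\tr (rho *m dheis O V H j th)).
Definition jtwo (l : 'I_m) : 'I_m -> nat := jinc l (jinc l (fun=> 0%N)).

Lemma loss_dloss : loss rho O V H = dloss (fun=> 0%N).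
Proof.
apply/funext => th; rewrite /dloss -heis_dheis /loss /heis; congr complex.Re.
by rewrite -!mulmxA mxtrace_mulC !mulmxA.
Qed.

Lemma is_derive_dloss j th l (t : R) :
  is_derive t 1 (fun s => dloss j (upd th l s)) (dloss (jinc l j) (upd th l t)).
Proof. by apply: is_derive_Re_trace; exact: mderiv_dheis. Qed.

Lemma pd_dloss j l : pd l (dloss j) = dloss (jinc l j).
Proof.
apply/funext => th; rewrite /pd derive1E.
by rewrite (@derive_val _ _ _ _ _ _ _ (is_derive_dloss j th l (th l))) upd_id.
Qed.

Lemma sep_dloss j : sep (dloss j).
Proof. by apply: sep_Re_trace; exact: msep_dheis. Qed.

Lemma dloss_le j th : `|dloss j th| <= opnorm (dheis O V H j th).
Proof. exact: Re_trace_density_le. Qed.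

Lemma c_coefE l : c_coef rho O V H phi l = `|dloss (jtwo l) phi|.
Proof. by rewrite /c_coef loss_dloss !pd_dloss. Qed.

Lemma omega_effE l : omega_eff O V H phi l ^+ 2 = opnorm (dheis O V H (jtwo l) phi).
Proof. by rewrite /omega_eff heis_dheis !(pdmx_dheis _ _ hH) sqr_sqrtr// opnorm_ge0. Qed.

Lemma omega_teffE l k : omega_teff O V H phi l k ^+ 2 =
  opnorm (dheis O V H (jinc k (jinc k (jtwo l))) phi).
Proof. by rewrite /omega_teff heis_dheis !(pdmx_dheis _ _ hH) sqr_sqrtr// opnorm_ge0. Qed.

Lemma jincC k l j : jinc k (jinc l j) = jinc l (jinc k j).
Proof. by apply/funext => i; rewrite /jinc; case: eqP; case: eqP. Qed.

Lemma jinc_gt (l k : 'I_m) j : (l < k)%N -> jinc l j k = j k.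
Proof. by move=> lk; rewrite /jinc ifF//; apply/negP => /eqP kl; rewrite kl ltnn in lk. Qed.

Lemma jtwo_gt (l k : 'I_m) : (l < k)%N -> jtwo l k = 0%N.
Proof. by move=> lk; rewrite /jtwo !jinc_gt. Qed.

Lemma omega_max_ge0 l : 0 <= omega_max H l.
Proof. exact: gap_ge0. Qed.

Lemma opnorm_dheis_jinc2 j th (l : 'I_m) : (forall k : 'I_m, (l < k)%N -> j k = 0%N) ->
  opnorm (dheis O V H (jinc l (jinc l j)) th) <=
  omega_max H l ^+ 2 * opnorm (dheis O V H j th).
Proof.
move=> j0; rewrite expr2 -mulrA.
have j1 : forall k : 'I_m, (l < k)%N -> jinc l j k = 0%N.
  by move=> k lk; rewrite jinc_gt// j0.
apply: le_trans (opnorm_dheis_jinc _ _ _ _ _ _) _ => //.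
by rewrite ler_wpM2l ?omega_max_ge0// opnorm_dheis_jinc.
Qed.

(** A bound on the second derivative in [l] of the evolved observable, valid at every point; its two
    cases are those of [beta]. *)
Definition curv_bound (l : 'I_m) : R :=
  if val l == 0%N then omega_eff O V H phi l ^+ 2 else omega_max H l ^+ 2 * opnorm O.

Lemma dheis_jtwo_le l th : opnorm (dheis O V H (jtwo l) th) <= curv_bound l.
Proof.
rewrite /curv_bound; case: eqP => l0.
  (* No coordinate precedes index 0, so the norm does not depend on the point and equals its value
     at [phi]. *)
  rewrite omega_effE le_eqVlt; apply/orP; left; apply/eqP.
  apply: (@opnorm_dheis_indep _ _ _ _ _ _ _ _ _ _ _ l) => // k; first exact: jtwo_gt.
  by rewrite l0.
by rewrite -(opnorm_dheis0 O uV hH th); exact: opnorm_dheis_jinc2.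
Qed.

Lemma curv_bound_ge0 l : 0 <= curv_bound l.
Proof. exact: le_trans (opnorm_ge0 _) (dheis_jtwo_le l phi). Qed.

Lemma c_coef_le l : c_coef rho O V H phi l <= curv_bound l.
Proof. by rewrite c_coefE; exact: le_trans (dloss_le _ _) (dheis_jtwo_le _ _). Qed.

Lemma beta_ge l : 2 / 3 * omega_max H l ^+ 2 * curv_bound l ^+ 2 <= beta O V H phi l.
Proof.
rewrite /beta /curv_bound; case: eqP => _; first by rewrite -exprM.
have : 0 <= omega_max H l ^+ 6 * opnorm O ^+ 2.
  by rewrite mulr_ge0// ?exprn_ge0 ?omega_max_ge0 ?opnorm_ge0.
have -> : 2 / 3 * omega_max H l ^+ 2 * (omega_max H l ^+ 2 * opnorm O) ^+ 2 =
  2 / 3 * (omega_max H l ^+ 6 * opnorm O ^+ 2) by ring.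
by rewrite -mulrA => ?; lra.
Qed.

Lemma A_coef_ge0 l : 0 <= A_coef O V H phi l.
Proof.
rewrite /A_coef addr_ge0//; last by apply: sumr_ge0 => k _; exact: sqr_ge0.
rewrite mulr_ge0//; first by rewrite mulr_ge0// sqr_ge0.
by apply: sumr_ge0 => k _; exact: sqr_ge0.
Qed.

#[local] Opaque omega_max omega_eff omega_teff curv_bound dloss.

Lemma eq_ler (x y : R) : x = y -> x <= y.
Proof. by move=> ->. Qed.

Section FixedCoordinate.
Variables (r : R) (l : 'I_m).
Hypothesis r0 : 0 < r.

Definition wlam (k : 'I_m) := if k == l then wmean (phi k) r else umean (phi k) r.

Lemma wlam_is_mean k : is_mean (wlam k).
Proof. by rewrite /wlam; case: ifP => _; [exact: wmean_is_mean|exact: umean_is_mean]. Qed.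

(** On both sides the mean over [l] is made innermost, where the double integration by parts
    applies; the other coordinates carry the same uniform mean on both sides. *)
Lemma lavg_qleg :
  lavg (fun k => umean (phi k) r) (enum 'I_m) (fun t => loss rho O V H t * qleg phi r l t) phi =
  2 * r ^+ 4 / 45 * lavg wlam (enum 'I_m) (dloss (jtwo l)) phi.
Proof.
have sL := sep_dloss (jtwo l).
have hu (k : 'I_m) : is_mean (umean (phi k) r) by exact: umean_is_mean.
rewrite loss_dloss.
rewrite (@lavg_rem _ _ _ hu _ _ _ l) ?enum_uniq ?mem_enum//; last first.
  by apply: sepM; [exact: sep_dloss|exact: sep_qleg].
rewrite (@lavg_rem _ _ _ wlam_is_mean _ _ _ l) ?enum_uniq ?mem_enum//.
rewrite -(lavgZ wlam_is_mean); last exact: sep_mean (wlam_is_mean l) sL.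
have -> : (fun t => umean (phi l) r (fun x => dloss (fun=> 0%N) (upd t l x) * qleg phi r l (upd t l x))) =
    (fun t => 2 * r ^+ 4 / 45 * wlam l (fun x => dloss (jtwo l) (upd t l x))).
  apply/funext => t; rewrite /wlam eqxx.
  under eq_fun do rewrite /qleg upd_same.
  apply: (@umean_leg2_parts _ (phi l) r (fun x => dloss (fun=> 0%N) (upd t l x))
    (fun x => dloss (jinc l (fun=> 0%N)) (upd t l x))) => //.
  - by move=> y; exact: is_derive_dloss.
  - by move=> y; exact: is_derive_dloss.
  - exact: sep_line.
set F := fun t => _ * _.
suff Es s th : l \notin s -> lavg (fun k => umean (phi k) r) s F th = lavg wlam s F th.
  by apply: Es; rewrite mem_rem_uniq ?enum_uniq// !inE eqxx.
elim: s th => //= k s IH th; rewrite inE negb_or eq_sym => /andP[kl ls].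
have -> : wlam k = umean (phi k) r by rewrite /wlam (negbTE kl).
by congr (umean _ _ _); apply/funext => x; exact: IH.
Qed.

(** Half the variance of the mean used, r^2/7 for the weighted coordinate and r^2/3 for the others,
    times a bound on the second derivative in [k] of the curvature. *)
Definition coord_bound (k : 'I_m) : R :=
  (if k == l then r ^+ 2 / 14 * (omega_max H l ^+ 2 * curv_bound l) else 0) +
  ((if (k < l)%N then r ^+ 2 / 6 * (omega_max H l ^+ 2 * omega_eff O V H phi k ^+ 2) else 0) +
   (if (l < k)%N then r ^+ 2 / 6 * omega_teff O V H phi l k ^+ 2 else 0)).

Lemma sum_coord_bound : \sum_(k <- enum 'I_m) coord_bound k <=
  r ^+ 2 / 14 * (omega_max H l ^+ 2 * curv_bound l) + A_coef O V H phi l * r ^+ 2 / 6.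
Proof.
apply: (@sum_split_ord_le _ _ l _ (r ^+ 2) (omega_max H l ^+ 2)
  (fun k => omega_eff O V H phi k ^+ 2) (fun k => omega_teff O V H phi l k ^+ 2)).
- exact: sqr_ge0.
- exact: sqr_ge0.
- by move=> k; exact: sqr_ge0.
Qed.

Lemma coord_taylor (k : 'I_m) th (v D : R) :
  wlam k (fun x => (x - phi k) ^+ 1) = 0 -> wlam k (fun x => (x - phi k) ^+ 2) = v ->
  th k = phi k ->
  (forall x, opnorm (dheis O V H (jinc k (jinc k (jtwo l))) (upd th k x)) <= D) ->
  `|wlam k (fun x => dloss (jtwo l) (upd th k x)) - dloss (jtwo l) th| <= D / 2 * v.
Proof.
move=> h1 h2 tk hD.
(* As [th k] is the centre [phi k], the value at [th] is the central value of the function of one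
   variable. *)
have -> : dloss (jtwo l) th = dloss (jtwo l) (upd th k (phi k)) by rewrite -tk upd_id.
apply: (@mean_taylor _ (wlam k) (phi k) v (fun x => dloss (jtwo l) (upd th k x))
  (fun x => dloss (jinc k (jtwo l)) (upd th k x))
  (fun x => dloss (jinc k (jinc k (jtwo l))) (upd th k x)) D (wlam_is_mean k) h1 h2).
- by move=> y; exact: is_derive_dloss.
- by move=> y; exact: is_derive_dloss.
- by move=> y; exact: le_trans (dloss_le _ _) (hD y).
Qed.

(** Since the coordinates before [k] sit at [phi], a norm whose last differentiated coordinate is at
    most [k] can be evaluated at [phi]; for [k > l] this gives [omega_teff] directly. For [k <= l]
    the two derivatives in [l] are first paid for by the spectral gap. *)
Lemma coord_step (k : 'I_m) th : (forall i : 'I_m, (i < k)%N -> th i = phi i) ->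
  th k = phi k ->
  `|wlam k (fun x => dloss (jtwo l) (upd th k x)) - dloss (jtwo l) th| <= coord_bound k.
Proof.
move=> tlt tk; rewrite /coord_bound.
have indep j x : (forall i : 'I_m, (k < i)%N -> j i = 0%N) ->
    opnorm (dheis O V H j (upd th k x)) = opnorm (dheis O V H j phi).
  move=> j0; apply: (opnorm_dheis_indep O uV hH j0) => i ik.
  by rewrite upd_diff ?tlt//; apply: contraTneq ik => ->; rewrite ltnn.
have [kl|lk|kl] := ltngtP k l.
- have kl' : (k == l) = false by apply: contraTF kl => /eqP ->; rewrite ltnn.
  rewrite kl' add0r addr0.
  have wE : wlam k = umean (phi k) r by rewrite /wlam kl'.
  apply: le_trans (@coord_taylor k th (r ^+ 2 / 3) (omega_max H l ^+ 2 * omega_eff O V H phi k ^+ 2)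
     _ _ tk _) _.
  + by rewrite wE umean_shift1.
  + by rewrite wE umean_shift2.
  (* Derivatives commute, so the two in [l] can be peeled off as the last ones. The two left in [k]
     have a norm that only sees coordinates before [k]. *)
  + move=> x; have -> : jinc k (jinc k (jtwo l)) = jinc l (jinc l (jtwo k)).
      by rewrite /jtwo !(jincC k l).
    apply: le_trans (opnorm_dheis_jinc2 _ _) _.
      by move=> i li; apply: jtwo_gt; exact: ltn_trans kl li.
    have e : opnorm (dheis O V H (jtwo k) (upd th k x)) = omega_eff O V H phi k ^+ 2.
      by apply: (etrans (indep _ x _) (esym (omega_effE k))) => i; exact: jtwo_gt.
    by rewrite [X in _ * X <= _]e; exact: lexx.
  + by set w := omega_max _ _ ^+ 2 * _; lra.
- have lk' : (k == l) = false by apply: contraTF lk => /eqP ->; rewrite ltnn.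
  rewrite lk' !add0r.
  have wE : wlam k = umean (phi k) r by rewrite /wlam lk'.
  apply: le_trans (@coord_taylor k th (r ^+ 2 / 3) (omega_teff O V H phi l k ^+ 2) _ _ tk _) _.
  + by rewrite wE umean_shift1.
  + by rewrite wE umean_shift2.
  + move=> x; apply: (eq_ler (etrans (indep _ x _) (esym (omega_teffE l k)))) => i ki.
    by rewrite !jinc_gt// jtwo_gt//; exact: ltn_trans lk ki.
  + by set w := omega_teff _ _ _ _ _ _ ^+ 2; lra.
- have {}kl : k = l by exact: val_inj.
  have kl' : (k == l) = true by rewrite kl eqxx.
  rewrite kl' !addr0.
  have wE : wlam k = wmean (phi k) r by rewrite /wlam kl'.
  apply: le_trans (@coord_taylor k th (r ^+ 2 / 7) (omega_max H l ^+ 2 * curv_bound l) _ _ tk _) _.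
  + by rewrite wE wmean_shift1.
  + by rewrite wE wmean_shift2.
  + move=> x; rewrite kl; apply: le_trans (opnorm_dheis_jinc2 _ _) _.
      by move=> i; exact: jtwo_gt.
    by apply: ler_wpM2l; [exact: sqr_ge0|exact: dheis_jtwo_le].
  + by set w := omega_max _ _ ^+ 2 * _; lra.
Qed.

Lemma curvature_lower_bound : A_coef O V H phi l * r ^+ 2 <= 6 * c_coef rho O V H phi l ->
  (c_coef rho O V H phi l - A_coef O V H phi l * r ^+ 2 / 6) ^+ 2
     - beta O V H phi l * r ^+ 2
  <= lavg wlam (enum 'I_m) (dloss (jtwo l)) phi ^+ 2.
Proof.
move=> hA.
have := lavg_telescope wlam_is_mean (sep_dloss (jtwo l)) (enum_ord_pairwise m) coord_step.
move=> /le_trans/(_ sum_coord_bound).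
have cM := c_coef_le l; have M0 := curv_bound_ge0 l; have hb := beta_ge l.
have A0 := A_coef_ge0 l.
move: hA cM; rewrite c_coefE.
set ft := lavg _ _ _ _; set g := dloss _ _; set A := A_coef _ _ _ _ _ in A0 *.
set b := beta _ _ _ _ _ in hb *; set M := curv_bound _ in M0 hb *.
set w2 := omega_max H l ^+ 2 in hb *.
have w20 : 0 <= w2 by exact: sqr_ge0.
move=> hA cM hft.
(* [dl] is the cost of the step [k = l]; [a] is what remains of the curvature at [phi] after the
   cost of all other coordinates. The hypothesis on [A_coef] says exactly that [a] is
   nonnegative. *)
pose dl := r ^+ 2 / 14 * (w2 * M); pose a := `|g| - A * r ^+ 2 / 6.
have r20 : 0 <= r ^+ 2 by exact: sqr_ge0.
have a0 : 0 <= a by rewrite /a; lra.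
have aM : a <= M by rewrite /a; have := mulr_ge0 A0 r20; lra.
have dl0 : 0 <= dl by rewrite /dl; apply: mulr_ge0; [exact: divr_ge0|exact: mulr_ge0].
have hd : 2 * a * dl <= b * r ^+ 2.
  apply: (@le_trans _ _ (2 * M * dl)).
    by rewrite ler_wpM2r// ler_wpM2l.
  have : 0 <= w2 * M ^+ 2 * r ^+ 2.
    by apply: mulr_ge0 => //; apply: mulr_ge0 => //; exact: sqr_ge0.
  have := ler_wpM2r r20 hb; rewrite /dl.
  set z := w2 * M ^+ 2 * r ^+ 2.
  have -> : 2 / 3 * w2 * M ^+ 2 * r ^+ 2 = 2 / 3 * z by rewrite /z; ring.
  have -> : 2 * M * (r ^+ 2 / 14 * (w2 * M)) = z / 7 by rewrite /z; field.
  by move=> ? ?; lra.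
have fta : a - dl <= `|ft|.
  have := ler_normB g ft; have : `|g - ft| <= dl + A * r ^+ 2 / 6 by rewrite distrC.
  have : `|g| <= `|g - ft| + `|ft| by rewrite -{1}[g](subrK ft) ler_normD.
  by rewrite /a; lra.
rewrite -/a -[leRHS]real_normK ?num_real//.
apply: (@le_trans _ _ (a ^+ 2 - 2 * a * dl)); first by lra.
(* If [a < dl] the inequality [a - dl <= |ft|] cannot be squared, but then a^2 - 2 a dl is
   nonpositive. *)
have [ad|da] := leP dl a.
  apply: (@le_trans _ _ ((a - dl) ^+ 2)).
    have -> : (a - dl) ^+ 2 = a ^+ 2 - 2 * a * dl + dl ^+ 2 by ring.
    by rewrite lerDl sqr_ge0.
  by rewrite ler_pXn2r ?nnegrE ?subr_ge0.
apply: le_trans (sqr_ge0 _).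
have -> : a ^+ 2 - 2 * a * dl = - (a * (dl - a) + a * dl) by ring.
by rewrite oppr_le0 addr_ge0// mulr_ge0// subr_ge0 ltW.
Qed.

End FixedCoordinate.

Lemma variance_lower_bound (r : R) (Lam : {set 'I_m}) : 0 < r ->
  (forall l, l \in Lam -> A_coef O V H phi l * r ^+ 2 <= 6 * c_coef rho O V H phi l) ->
  \sum_(l in Lam) (r ^+ 4 / 45 * ((c_coef rho O V H phi l - A_coef O V H phi l * r ^+ 2 / 6) ^+ 2
      - beta O V H phi l * r ^+ 2))
    <= unif_var phi r (loss rho O V H).
Proof.
move=> r0 hA; have sL : sep (loss rho O V H) by rewrite loss_dloss; exact: sep_dloss.
apply: le_trans (bessel_variance phi r0 Lam sL); apply: ler_sum => l lL.
rewrite (lavg_qleg l r0); set ft := lavg _ _ _ _.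
have -> : (2 * r ^+ 4 / 45 * ft) ^+ 2 / (4 * r ^+ 4 / 45) = r ^+ 4 / 45 * ft ^+ 2.
  by field; rewrite gt_eqF.
apply: ler_wpM2l; first by rewrite divr_ge0// exprn_ge0// ltW.
exact: (curvature_lower_bound r0 (hA l lL)).
Qed.

End Curvature.

(** * The patch radius *)

Lemma sum_le_card (R : realType) (m : nat) (P : pred 'I_m) (F : 'I_m -> R) (x : R) :
  0 <= x -> (forall k, P k -> F k <= x) -> \sum_(k < m | P k) F k <= m%:R * x.
Proof.
move=> x0 h; apply: (@le_trans _ _ (\sum_(k < m | P k) x)); first exact: ler_sum.
apply: (@le_trans _ _ (\sum_(k < m) x)).
  by rewrite [leLHS]big_mkcond; apply: ler_sum => k _; case: ifP.
by rewrite sumr_const card_ord mulr_natl.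
Qed.

Lemma qdim_gt0 n : (0 < qdim n)%N.
Proof. by rewrite expn_gt0. Qed.

#[local] Opaque omega_max omega_eff omega_teff curv_bound dloss.

Section Patch.
Variables (R : realType) (d m : nat) (rho O : 'M[R[i]]_d) (V H : 'I_m -> 'M[R[i]]_d)
  (phi : 'I_m -> R).
Hypotheses (d0 : (0 < d)%N) (hrho : density_operator rho) (uV : forall l, unitary (V l))
  (hH : forall l, is_hermitian (H l)).

Let c := c_coef rho O V H phi.
Let A := A_coef O V H phi.
Let b := beta O V H phi.

Let c0 l : 0 <= c l. Proof. exact: normr_ge0. Qed.
Let A0 l : 0 <= A l. Proof. exact: A_coef_ge0. Qed.
Let b0 l : 0 <= b l.
Proof.
apply: le_trans (beta_ge O V phi d0 hH l).
by apply: mulr_ge0; [apply: mulr_ge0 => //; exact: sqr_ge0|exact: sqr_ge0].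
Qed.

(** Dropping the nonnegative term in [b] and dividing by 8 [c l] gives even A r^2 <= (9/8) c. *)
Lemma patch_radius_A l (r : R) : 0 < r ->
  r ^+ 2 * (8 * c l * A l + 24 * b l) <= 9 * c l ^+ 2 -> 0 < c l ->
  A l * r ^+ 2 <= 6 * c l.
Proof.
move=> r0 h cp; rewrite -(ler_pM2l cp).
have r20 := sqr_ge0 r.
have h1 := mulr_ge0 r20 (b0 l).
have -> : c l * (A l * r ^+ 2) = r ^+ 2 * (c l * A l) by ring.
have -> : c l * (6 * c l) = 6 * c l ^+ 2 by ring.
move: h; rewrite (_ : r ^+ 2 * (8 * c l * A l + 24 * b l) =
  8 * (r ^+ 2 * (c l * A l)) + 24 * (r ^+ 2 * b l)); last by ring.
have := sqr_ge0 (c l).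
move: h1; move: (r ^+ 2 * (c l * A l)) (r ^+ 2 * b l) (c l ^+ 2) => x y z; lra.
Qed.

(** The loss linear in r^2 is 1/24 of the left side of the hypothesis, hence at most (9/24) c^2,
    which leaves 1 - 3/8 = 5/8. *)
Lemma patch_term_ge l (r : R) : r ^+ 2 * (8 * c l * A l + 24 * b l) <= 9 * c l ^+ 2 ->
  5 / 8 * c l ^+ 2 <= (c l - A l * r ^+ 2 / 6) ^+ 2 - b l * r ^+ 2.
Proof.
move=> h.
have -> : (c l - A l * r ^+ 2 / 6) ^+ 2 - b l * r ^+ 2 = c l ^+ 2
   - r ^+ 2 * (8 * c l * A l + 24 * b l) / 24 + (A l * r ^+ 2 / 6) ^+ 2 by field.
have := sqr_ge0 (A l * r ^+ 2 / 6).
move: h; move: (r ^+ 2 * _) (c l ^+ 2) ((A l * r ^+ 2 / 6) ^+ 2) => x y z; lra.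
Qed.

Lemma patch_variance (r : R) (Lam : {set 'I_m}) : 0 < r ->
  (forall l, l \in Lam -> 0 < c l /\
     r ^+ 2 * (8 * c l * A l + 24 * b l) <= 9 * c l ^+ 2) ->
  1 / 72 * (\sum_(l in Lam) c l ^+ 2) * r ^+ 4 <= unif_var phi r (loss rho O V H).
Proof.
move=> r0 h.
apply: le_trans (variance_lower_bound d0 hrho uV hH r0 (Lam := Lam) _); last first.
  by move=> l /h[cp hr]; exact: patch_radius_A.
rewrite mulrAC mulr_sumr; apply: ler_sum => l /h[_ hr].
have := ler_wpM2l (exprn_ge0 4 (ltW r0)) (patch_term_ge hr).
rewrite -/c -/A -/b; set T := _ - b l * _.
have -> : 1 / 72 * r ^+ 4 * c l ^+ 2 = r ^+ 4 * (5 / 8 * c l ^+ 2) / 45 by field.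
have -> : r ^+ 4 / 45 * T = r ^+ 4 * T / 45 by field.
by move: (r ^+ 4 * _) (r ^+ 4 * T) => x y; lra.
Qed.

Lemma rpatch2_le (r : R) (Lam : {set 'I_m}) : 0 < r ->
  r ^+ 2 <= rpatch2 rho O V H phi Lam -> forall l, l \in Lam -> 0 < c l /\
     r ^+ 2 * (8 * c l * A l + 24 * b l) <= 9 * c l ^+ 2.
Proof.
move=> r0 hr l lL; set D := 8 * c l * A l + 24 * b l.
have D0 : 0 <= D.
  apply: addr_ge0; last by apply: mulr_ge0.
  by apply: mulr_ge0 => //; apply: mulr_ge0.
have hl : r ^+ 2 <= 9 * c l ^+ 2 / D.
  apply: le_trans hr _; apply: ge_inf; last by exists l.
  exists 0 => _ [k /= _ <-].
  apply: divr_ge0; first by apply: mulr_ge0 => //; exact: sqr_ge0.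
  apply: addr_ge0; last by apply: mulr_ge0 => //; exact: b0.
  by apply: mulr_ge0; [apply: mulr_ge0 => //; exact: c0|exact: A0].
have r20 : 0 < r ^+ 2 by exact: exprn_gt0.
(* Division by zero yields 0, so a vanishing denominator would force r^2 <= 0; the same happens
   below if [c l] vanishes. *)
have Dp : 0 < D.
  rewrite lt_neqAle D0 andbT; apply/negP => /eqP D00.
  by move: hl; rewrite -D00 invr0 mulr0 leNgt r20.
split; last by rewrite -ler_pdivlMr.
rewrite lt_neqAle c0 andbT; apply/negP => /eqP c00.
by move: hl; rewrite -c00 expr0n mulr0 mul0r leNgt r20.
Qed.

Lemma rpatch2_ge0 (Lam : {set 'I_m}) : Lam != finset.set0 ->
  0 <= rpatch2 rho O V H phi Lam.
Proof.
move=> /set0Pn[l lL]; apply: lb_le_inf; first by eexists; exists l.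
move=> _ [k /= _ <-].
apply: divr_ge0; first by apply: mulr_ge0 => //; exact: sqr_ge0.
apply: addr_ge0; last by apply: mulr_ge0 => //; exact: b0.
by apply: mulr_ge0; [apply: mulr_ge0 => //; exact: c0|exact: A0].
Qed.

(** At radius 0 the prefactor is the inverse of 0, which is 0 by convention, so with at least one
    coordinate every mean vanishes. *)
Lemma unif_var_radius0 (f : ('I_m -> R) -> R) : (0 < m)%N -> unif_var phi 0 f = 0.
Proof.
move=> m0.
have E g : unif_mean phi 0 g = 0.
  rewrite unif_mean_lavg; have : (0 < size (enum 'I_m))%N by rewrite size_enum_ord.
  by case: (enum 'I_m) => //= k s _; rewrite /umean mulr0 invr0 mul0r.
by rewrite /unif_var !E expr0n subrr.
Qed.

(** * Polynomial bounds for the asymptotic statement *)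

Section PolynomialBounds.
Variable B : R.
Hypotheses (B1 : 1 <= B) (hO : opnorm O <= B) (hHB : forall k, opnorm (H k) <= B).

Let B0 : 0 <= B. Proof. exact: le_trans ler01 B1. Qed.

Let w2B l : omega_max H l ^+ 2 <= 4 * B ^+ 2.
Proof.
have -> : 4 * B ^+ 2 = (2 * B) ^+ 2 by ring.
rewrite ler_pXn2r ?nnegrE ?mulr_ge0// ?omega_max_ge0//.
have h : omega_max H l <= 2 * opnorm (H l) by exact: gap_le.
exact: (le_trans h (ler_wpM2l (ler0n _ 2) (hHB l))).
Qed.

Let omega_eff_poly l : omega_eff O V H phi l ^+ 2 <= 4 * B ^+ 3.
Proof.
have h := @opnorm_dheis_jinc2 _ _ _ O V H d0 uV hH (fun=> 0%N) phi l (fun _ _ => erefl).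
rewrite (omega_effE O V phi hH); apply: le_trans h _.
have e : opnorm (dheis O V H (fun=> 0%N) phi) <= B.
  by rewrite (opnorm_dheis0 O uV hH phi).
have -> : 4 * B ^+ 3 = 4 * B ^+ 2 * B by ring.
by apply: ler_pM (w2B l) e; [exact: sqr_ge0|exact: opnorm_ge0].
Qed.

Let omega_teff_poly (l k : 'I_m) : (l < k)%N -> omega_teff O V H phi l k ^+ 2 <= 16 * B ^+ 5.
Proof.
move=> lk.
have j0 (i : 'I_m) : (k < i)%N -> jtwo l i = 0%N.
  by move=> ki; apply: jtwo_gt; exact: ltn_trans lk ki.
have h := @opnorm_dheis_jinc2 _ _ _ O V H d0 uV hH (jtwo l) phi k j0.
rewrite (omega_teffE O V phi hH); apply: le_trans h _.
rewrite -(omega_effE O V phi hH).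
have -> : 16 * B ^+ 5 = 4 * B ^+ 2 * (4 * B ^+ 3) by ring.
by apply: ler_pM (w2B k) (omega_eff_poly l); exact: sqr_ge0.
Qed.

(** A spectral gap is at most 2 B. The first sum contributes 4 * 4 * 4 = 64 and the second 16, with
    B^5 in both. *)
Lemma A_coef_poly l : A l <= 80 * B ^+ 5 * m%:R.
Proof.
have Bn n : 0 <= B ^+ n by exact: exprn_ge0.
have h1 : \sum_(k < m | (k < l)%N) omega_eff O V H phi k ^+ 2 <= m%:R * (4 * B ^+ 3).
  by apply: sum_le_card => [|k _]; [exact: mulr_ge0|exact: omega_eff_poly].
have h2 : \sum_(k < m | (l < k)%N) omega_teff O V H phi l k ^+ 2 <= m%:R * (16 * B ^+ 5).
  by apply: sum_le_card => [|k lk]; [exact: mulr_ge0|exact: omega_teff_poly].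
have -> : 80 * B ^+ 5 * m%:R = 4 * (4 * B ^+ 2) * (m%:R * (4 * B ^+ 3)) + m%:R * (16 * B ^+ 5).
  by ring.
apply: lerD h2; apply: ler_pM h1.
- by apply: mulr_ge0 => //; exact: sqr_ge0.
- by apply: sumr_ge0 => k _; exact: sqr_ge0.
- by apply: ler_wpM2l => //; exact: w2B.
Qed.

(** The larger case gives (32/3) * 64 = 682.7, rounded up to 700. *)
Lemma beta_poly l : b l <= 700 * B ^+ 8.
Proof.
have Bn n : 0 <= B ^+ n by exact: exprn_ge0.
have B8 := Bn 8%N.
rewrite /b /beta; case: eqP => _.
  have h1 : omega_max H l ^+ 2 * omega_eff O V H phi l ^+ 4 <= 4 * B ^+ 2 * (4 * B ^+ 3) ^+ 2.
    apply: ler_pM (w2B l) _; [exact: sqr_ge0|by apply: exprn_ge0; exact: sqrtr_ge0|].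
    rewrite (exprM _ 2 2); apply: lerXn2r (omega_eff_poly l); rewrite nnegrE; first exact: sqr_ge0.
    exact: mulr_ge0.
  rewrite -[leLHS]mulrA; move: h1.
  have -> : 4 * B ^+ 2 * (4 * B ^+ 3) ^+ 2 = 64 * B ^+ 8 by ring.
  by move: (omega_max _ _ ^+ 2 * _) => x h1; lra.
have h1 : omega_max H l ^+ 6 * opnorm O ^+ 2 <= (4 * B ^+ 2) ^+ 3 * B ^+ 2.
  apply: ler_pM.
  - by apply: exprn_ge0; exact: omega_max_ge0.
  - exact: sqr_ge0.
  - rewrite (exprM _ 2 3); apply: lerXn2r (w2B l); rewrite nnegrE; first exact: sqr_ge0.
    exact: mulr_ge0.
  - by apply: lerXn2r hO; rewrite nnegrE ?opnorm_ge0.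
rewrite -[leLHS]mulrA; move: h1.
have -> : (4 * B ^+ 2) ^+ 3 * B ^+ 2 = 64 * B ^+ 8 by ring.
by move: (omega_max _ _ ^+ 6 * _) => x h1; lra.
Qed.

Lemma poly_radius (q : 'I_m) (g r : R) : 1 <= g -> 1 <= c q * g -> 0 < r ->
  r ^+ 2 * m%:R * (100 * B ^+ 4 * g) ^+ 2 <= 1 ->
  r ^+ 2 * (8 * c q * A q + 24 * b q) <= 9 * c q ^+ 2.
Proof.
move=> g1 cg r0 hr.
have m1 : 1 <= m%:R :> R by rewrite ler1n (leq_ltn_trans _ (ltn_ord q)).
have Bn n : 0 <= B ^+ n by exact: exprn_ge0.
have r20 := sqr_ge0 r; have mr0 : 0 <= m%:R :> R by exact: ler0n.
have g0 : 0 <= g by exact: le_trans ler01 g1.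
(* [y] dominates both error terms: r^2 A <= 80 y and r^2 b <= 700 y. As y and c y are at most
   c^2/10000, the total is (640 + 16800)/10000 c^2, below 9 c^2; this is where the factor 100 in the
   radius comes from. *)
pose y := r ^+ 2 * m%:R * B ^+ 8.
have y0 : 0 <= y by apply: mulr_ge0 => //; exact: mulr_ge0.
have hy : y * g ^+ 2 <= 1 / 10000.
  have -> : y * g ^+ 2 = r ^+ 2 * m%:R * (100 * B ^+ 4 * g) ^+ 2 / 10000 by rewrite /y; field.
  by move: hr; move: (r ^+ 2 * _ * _) => x hx; lra.
have y2 : y <= 1 / 10000 * c q ^+ 2.
  have h1 : 1 <= (c q * g) ^+ 2 by exact: exprn_ege1.
  apply: le_trans (ler_wpM2r (sqr_ge0 (c q)) hy).
  have -> : y * g ^+ 2 * c q ^+ 2 = y * (c q * g) ^+ 2 by ring.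
  by rewrite -[leLHS]mulr1; exact: ler_wpM2l.
have y1 : c q * y <= 1 / 10000 * c q ^+ 2.
  have h1 : 1 <= g * (c q * g) by exact: mulr_ege1.
  have h2 : y <= 1 / 10000 * c q.
    apply: le_trans (ler_wpM2r (c0 q) hy).
    have -> : y * g ^+ 2 * c q = y * (g * (c q * g)) by ring.
    by rewrite -[leLHS]mulr1; exact: ler_wpM2l.
  have := ler_wpM2l (c0 q) h2; have -> : c q * (1 / 10000 * c q) = 1 / 10000 * c q ^+ 2 by ring.
  by [].
have hA : r ^+ 2 * A q <= 80 * y.
  apply: le_trans (ler_wpM2l r20 (A_coef_poly q)) _.
  have -> : r ^+ 2 * (80 * B ^+ 5 * m%:R) = 80 * (r ^+ 2 * m%:R * B ^+ 5) by ring.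
  apply: ler_wpM2l; first exact: ler0n.
  rewrite /y; apply: ler_wpM2l; first exact: mulr_ge0.
  exact: ler_weXn2l.
have hb : r ^+ 2 * b q <= 700 * y.
  apply: le_trans (ler_wpM2l r20 (beta_poly q)) _.
  have -> : r ^+ 2 * (700 * B ^+ 8) = 700 * (r ^+ 2 * B ^+ 8) by ring.
  apply: ler_wpM2l; first exact: ler0n.
  rewrite /y; apply: ler_wpM2r; first exact: Bn.
  by rewrite -[leLHS]mulr1; exact: ler_wpM2l.
have -> : r ^+ 2 * (8 * c q * A q + 24 * b q) = 8 * (c q * (r ^+ 2 * A q)) + 24 * (r ^+ 2 * b q).
  by ring.
have := ler_wpM2l (c0 q) hA; have -> : c q * (80 * y) = 80 * (c q * y) by ring.
have := sqr_ge0 (c q).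
move: y1 y2 hb; move: (c q * (r ^+ 2 * A q)) (r ^+ 2 * b q) (c q * y) (c q ^+ 2) => x1 x2 x3 x4; lra.
Qed.

End PolynomialBounds.
End Patch.

Theorem theorem3 :
  (* (i) and (ii): a single instance *)
  (forall (R : realType) (n m : nat) (rho O : 'M[R[i]]_(qdim n))
     (V H : 'I_m -> 'M[R[i]]_(qdim n)) (phi : 'I_m -> R) (Lam : {set 'I_m}),
     density_operator rho -> is_hermitian O ->
     (forall l, unitary (V l)) -> (forall l, is_hermitian (H l)) ->
     Lam != finset.set0 ->
     let L := loss rho O V H in
     let c := c_coef rho O V H phi in
     let A := A_coef O V H phi in
     let b := beta O V H phi in
     let rp2 := rpatch2 rho O V H phi Lam in
     (forall r : R, 0 < r -> r ^+ 2 <= rp2 ->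
        \sum_(l in Lam) (r ^+ 4 / 45 * ((c l - A l * r ^+ 2 / 6) ^+ 2 - b l * r ^+ 2))
          <= unif_var phi r L)
     /\
     1 / 72 * (\sum_(l in Lam) c l ^+ 2) * rp2 ^+ 2 <= unif_var phi (Num.sqrt rp2) L)
  /\
  (* (iii): asymptotic statement for a family of instances indexed by n *)
  (forall (R : realType) (m : nat -> nat)
     (rho O : forall n, 'M[R[i]]_(qdim n))
     (V H : forall n, 'I_(m n) -> 'M[R[i]]_(qdim n))
     (phi : forall n, 'I_(m n) -> R) (q : forall n, 'I_(m n)),
     (forall n, density_operator (rho n) /\ is_hermitian (O n) /\
                (forall l, unitary (V n l) /\ is_hermitian (H n l))) ->
     (* ||O||_oo, ||H_k||_oo in O(poly(n)) *)
     (exists (C : R) (a N : nat), forall n, (N <= n)%N ->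
        opnorm (O n) <= C * n%:R ^+ a /\ (forall k, opnorm (H n k) <= C * n%:R ^+ a)) ->
     (* c_q(phi) in Omega(1/poly(n)) *)
     (exists (C : R) (a N : nat), 0 < C /\ forall n, (N <= n)%N ->
        1 / (C * n%:R ^+ a) <= c_coef (rho n) (O n) (V n) (H n) (phi n) (q n)) ->
     (* a suitable r in Theta(1/(poly(n) sqrt m)) gives Var in Omega(1/(poly(n) m^2)) *)
     exists (K : R) (b : nat), 0 < K /\
       forall (r : nat -> R) (kappa : R), 0 < kappa ->
       (forall n, kappa / (K * n%:R ^+ b * Num.sqrt (m n)%:R) <= r n
                  <= 1 / (K * n%:R ^+ b * Num.sqrt (m n)%:R)) ->
       exists (C' : R) (b' N' : nat), 0 < C' /\ forall n, (N' <= n)%N ->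
         1 / (C' * n%:R ^+ b' * (m n)%:R ^+ 2)
           <= unif_var (phi n) (r n) (loss (rho n) (O n) (V n) (H n))).
Proof.
split.
  move=> R n m rho O V H phi Lam hrho hO uV hH Lam0 L c A b rp2.
  have d0 := qdim_gt0 n.
  split.
    move=> r r0 hr; apply: (variance_lower_bound d0 hrho uV hH r0) => l lL.
    have [cp h] := rpatch2_le d0 hH r0 hr lL.
    exact: (patch_radius_A d0 hH r0 h cp).
  have rp0 : 0 <= rp2 by exact: rpatch2_ge0.
  (* [patch_variance] needs a positive radius; for a patch of radius 0 both sides are 0. *)
  have [rp00|rpn] := eqVneq rp2 0.
    have m0 : (0 < m)%N.
      by have /set0Pn[l _] := Lam0; exact: leq_ltn_trans (ltn_ord l).
    by rewrite rp00 sqrtr0 (unif_var_radius0 phi _ m0) expr0n mulr0.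
  have rp : 0 < Num.sqrt rp2 by rewrite sqrtr_gt0 lt_neqAle eq_sym rpn.
  have r2 : Num.sqrt rp2 ^+ 2 = rp2 by rewrite sqr_sqrtr.
  have hr : Num.sqrt rp2 ^+ 2 <= rp2 by rewrite r2.
  have := patch_variance d0 hrho uV hH rp (rpatch2_le d0 hH rp hr).
  by rewrite (exprM _ 2 2) r2.
move=> R m rho O V H phi q hyp [C1 [a1 [N1 h1]]] [C2 [a2 [N2 [C20 h2]]]].
(* Enlarged constants, so that for n >= 1 both B = C n^a1 and g = G n^a2 are at least 1, as
   [poly_radius] requires. *)
pose C := `|C1| + 1; pose G := C2 + 1.
have C1' : 1 <= C by rewrite /C lerDr.
have G1 : 1 <= G by rewrite /G; lra.
have C0 : 0 < C by exact: lt_le_trans ltr01 C1'.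
have G0 : 0 < G by exact: lt_le_trans ltr01 G1.
(* Chosen so that K n^e = 100 B^4 g, the scale in [poly_radius]. *)
pose K := 100 * C ^+ 4 * G; pose e := (4 * a1 + a2)%N.
have K0 : 0 < K by apply: mulr_gt0 => //; apply: mulr_gt0 => //; exact: exprn_gt0.
exists K, e; split => // r kappa k0 hr.
(* Read off from (1/72) (1/g)^2 (kappa/(K n^e sqrt m))^4, a lower bound for c_q^2 r^4/72; the fourth
   power of the root gives m^2. The final + 1 in the threshold excludes n = 0. *)
exists (72 * G ^+ 2 * K ^+ 4 / kappa ^+ 4), (2 * a2 + 4 * e)%N, (N1 + N2 + 1)%N; split.
  apply: divr_gt0; last exact: exprn_gt0.
  by apply: mulr_gt0; [apply: mulr_gt0 => //; exact: exprn_gt0|exact: exprn_gt0].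
move=> n hn.
have n1 : (0 < n)%N by apply: leq_trans hn; rewrite addn1.
have nN1 : (N1 <= n)%N by apply: leq_trans hn; rewrite -addnA leq_addr.
have nN2 : (N2 <= n)%N by apply: leq_trans hn; rewrite addnAC addnC leq_addr.
have m0 : (0 < m n)%N by exact: leq_ltn_trans (ltn_ord (q n)).
have [hrho [hO uVH]] := hyp n.
have uV l := (uVH l).1; have hH l := (uVH l).2.
have d0 := qdim_gt0 n.
set x : R := n%:R; have x1 : 1 <= x by rewrite ler1n.
have x0 : 0 < x by rewrite ltr0n.
have xp j : 0 < x ^+ j by exact: exprn_gt0.
have xe j : 1 <= x ^+ j by exact: exprn_ege1.
pose B := C * x ^+ a1; pose g := G * x ^+ a2.
have B1 : 1 <= B by exact: mulr_ege1.
have g1 : 1 <= g by exact: mulr_ege1.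
have g0 : 0 < g by exact: lt_le_trans ltr01 g1.
have CB : C1 * x ^+ a1 <= B.
  by apply: ler_wpM2r; [exact: ltW|rewrite /C; have := ler_norm C1; lra].
have [hO1 hH1] := h1 n nN1.
have hOB : opnorm (O n) <= B by exact: le_trans hO1 CB.
have hHB k : opnorm (H n k) <= B by exact: le_trans (hH1 k) CB.
set cq := c_coef (rho n) (O n) (V n) (H n) (phi n) (q n).
have hcg : 1 <= cq * g.
  have C2x : 0 < C2 * x ^+ a2 by exact: mulr_gt0.
  have := h2 n nN2; rewrite -/cq -/x ler_pdivrMr// => h.
  apply: le_trans h _; apply: ler_wpM2l; first exact: normr_ge0.
  by apply: ler_wpM2r; [exact: ltW|rewrite /G; lra].
set mr : R := (m n)%:R; have mr0 : 0 < mr by rewrite ltr0n.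
set sm := Num.sqrt mr; have sm0 : 0 < sm by rewrite sqrtr_gt0.
have sm2 : sm ^+ 2 = mr by rewrite sqr_sqrtr// ltW.
pose X := K * x ^+ e; have X0 : 0 < X by exact: mulr_gt0.
have XE : X = 100 * B ^+ 4 * g.
  by rewrite /X /K /B /g /e exprMn -exprM exprD (mulnC 4%N); ring.
have /andP[hr1 hr2] := hr n.
have Xsm : 0 < X * sm by exact: mulr_gt0.
have rlow : kappa / (X * sm) <= r n by [].
have rp : 0 < r n by apply: lt_le_trans rlow; exact: divr_gt0.
have rup : r n * (X * sm) <= 1 by rewrite -ler_pdivlMr.
have cond : r n ^+ 2 * (m n)%:R * (100 * B ^+ 4 * g) ^+ 2 <= 1.
  rewrite -XE -/mr -sm2.
  have -> : r n ^+ 2 * sm ^+ 2 * X ^+ 2 = (r n * (X * sm)) ^+ 2 by ring.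
  by apply: exprn_ile1 => //; apply: mulr_ge0; exact: ltW.
have hpoly := poly_radius d0 uV hH B1 hOB hHB g1 hcg rp cond.
have cp : 0 < cq.
  by rewrite -(pmulr_lgt0 _ g0); exact: lt_le_trans ltr01 hcg.
(* One coordinate with non-negligible curvature is enough, so the patch bound is used with the
   singleton of [q n]. *)
have := @patch_variance _ _ _ (rho n) (O n) (V n) (H n) (phi n) d0 hrho uV hH (r n)
  [set q n]%SET rp.
have hq l : l \in [set q n]%SET -> 0 < c_coef (rho n) (O n) (V n) (H n) (phi n) l /\
   r n ^+ 2 * (8 * c_coef (rho n) (O n) (V n) (H n) (phi n) l * A_coef (O n) (V n) (H n) (phi n) l
     + 24 * beta (O n) (V n) (H n) (phi n) l) <= 9 * c_coef (rho n) (O n) (V n) (H n) (phi n) l ^+ 2.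
  by rewrite inE => /eqP ->.
move=> /(_ hq); rewrite big_set1 -/cq; apply: le_trans.
have -> : 1 / (72 * G ^+ 2 * K ^+ 4 / kappa ^+ 4 * x ^+ (2 * a2 + 4 * e) * mr ^+ 2) =
    1 / 72 * (1 / g) ^+ 2 * (kappa / (X * sm)) ^+ 4.
  have -> : mr ^+ 2 = sm ^+ 4 by rewrite -sm2 -exprM.
  have -> : x ^+ (2 * a2 + 4 * e) = (x ^+ a2) ^+ 2 * (x ^+ e) ^+ 4.
    by rewrite exprD mulnC (mulnC 4%N) !exprM.
  rewrite /g /X; field.
  by rewrite !gt_eqF.
have hc : 1 / g <= cq by rewrite ler_pdivrMr.
apply: ler_pM.
- by apply: mulr_ge0 => //; exact: sqr_ge0.
- by apply: exprn_ge0; apply: divr_ge0; exact: ltW.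
- apply: ler_wpM2l => //; apply: lerXn2r hc; rewrite nnegrE ?normr_ge0//.
  by apply: divr_ge0 => //; exact: ltW.
- by apply: lerXn2r rlow; rewrite nnegrE; [apply: divr_ge0|]; exact: ltW.
Qed.
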